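(* Let $A\in M_n(\mathbb C)$ be a generic matrix. Then the Kippenhahn curve $C(A)$ of $A$ consists of the closed components $$\gamma_k(A)=\{\langle A z_k(\theta),z_k(\theta)\rangle\colon \theta\in[0,2\pi]\},\qquad k=1,\ldots,\lceil n/2\rceil,$$ where $z_k(\theta)$ is a unit eigenvector associated with the eigenvalue $\lambda_k(\theta)$ of $\operatorname{Re}(e^{i\theta}A)$. Respectively, for each $k=1,\ldots,\lceil n/2\rceil$, the half-planes in the representation $$\Lambda_k(A)=\bigcap_{\theta\in[0,2\pi)}\{\mu\in\mathbb C\colon \operatorname{Re}(e^{i\theta}\mu)\le\lambda_k(\theta)\}$$ of the rank-$k$ numerical range of $A$ are bounded by the family of lines $\ell_{\theta,k}=\{\mu\in\mathbb C\colon \operatorname{Re}(e^{i\theta}\mu)=\lambda_k(\theta)\}$, which are the tangent lines of $\gamma_k(A)$.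
   Context: $M_n(\mathbb C)$ is the algebra of $n\times n$ complex matrices, acting on $\mathbb C^n$ with the standard scalar product $\langle\cdot,\cdot\rangle$. For $X\in M_n(\mathbb C)$, $\operatorname{Re}X=(X+X^* )/2$. For $A\in M_n(\mathbb C)$ and real $\theta$, $\lambda_k(\theta)$ denotes the $k$-th largest eigenvalue (counting multiplicities) of the Hermitian matrix $\operatorname{Re}(e^{i\theta}A)$. The matrix $A$ is generic if $\lambda_1(\theta),\ldots,\lambda_n(\theta)$ are distinct for every $\theta$. The rank-$k$ numerical range is $\Lambda_k(A)=\{\lambda\in\mathbb C\colon PAP=\lambda P\text{ for some rank-}k\text{ orthogonal projection }P\}$; by a known theorem of Li and Sze it admits the displayed half-plane representation for every $A$. The Kippenhahn curve $C(A)$ is the envelope of the family of all lines $\ell_{\theta,k}$, $\theta\in[0,2\pi)$, $k=1,\ldots,n$. For generic $A$ (where each $\lambda_k(\theta)$ is a smooth function of $\theta$), this envelope is the set of all points $\mu\in\mathbb C$ for which there are $k$ and $\theta$ with $\operatorname{Re}(e^{i\theta}\mu)=\lambda_k(\theta)$ and $\frac{d}{d\theta}\operatorname{Re}(e^{i\theta}\mu)=\lambda_k'(\theta)$; the line $\ell_{\theta,k}$ is tangent to the envelope of the family $\{\ell_{\theta,k}\}_\theta$ at the point so determined by $\theta$ (tangency being understood in this envelope sense, including when the curve has cusps or degenerates to a point). *)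

(* Defs.v *)
From HB Require Import structures.
From mathcomp Require Import all_boot all_order all_algebra.
From mathcomp Require Import complex.
From mathcomp Require Import all_classical all_reals all_analysis.
Set Implicit Arguments.
Unset Strict Implicit.
Unset Printing Implicit Defensive.
Import Order.TTheory GRing.Theory Num.Theory.
Import numFieldNormedType.Exports.
Local Open Scope classical_set_scope.
Local Open Scope ring_scope.
Local Open Scope sesquilinear_scope.

Definition cis (R : realType) (theta : R) : R[i] :=
  (cos theta +i* sin theta)%C.

Definition inner (R : realType) (n : nat) (x y : 'cV[R[i]]_n) : R[i] :=
  \sum_(i < n) x i 0 * Num.conj (y i 0).

Definition hermitian_part (R : realType) (n : nat) (X : 'M[R[i]]_n) :
  'M[R[i]]_n := 2^-1 *: (X + X^t*).

(* The roots of the characteristic polynomial, with algebraic multiplicities,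
   in decreasing order. This is meant for a Hermitian M, all of whose
   eigenvalues are real, so that taking real parts loses nothing. *)
Definition herm_eigenvalues (R : realType) (n : nat) (M : 'M[R[i]]_n) :
    seq R :=
  sort >=%R [seq complex.Re x |
               x <- sval (closed_field_poly_normal (char_poly M))].

(* The index k is 1-based, 1 <= k <= n. *)
Definition lambda (R : realType) (n : nat) (A : 'M[R[i]]_n) (k : nat)
    (theta : R) : R :=
  nth 0 (herm_eigenvalues (hermitian_part (cis theta *: A))) k.-1.

Definition generic (R : realType) (n : nat) (A : 'M[R[i]]_n) : Prop :=
  forall (theta : R) (j k : nat), (1 <= j <= n)%N -> (1 <= k <= n)%N ->
    j <> k -> lambda A j theta <> lambda A k theta.

Definition unit_eigenvector (R : realType) (n : nat) (M : 'M[R[i]]_n)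
    (a : R) (z : 'cV[R[i]]_n) : Prop :=
  M *m z = (a%:C)%C *: z /\ inner z z = 1.

Definition orthogonal_projection (R : realType) (n : nat) (P : 'M[R[i]]_n) :
  Prop := P *m P = P /\ P^t* = P.

Definition rank_numerical_range (R : realType) (n : nat) (k : nat)
    (A : 'M[R[i]]_n) : set R[i] :=
  [set mu | exists P : 'M[R[i]]_n,
     [/\ orthogonal_projection P, \rank P = k & P *m A *m P = mu *: P]].

(* Families of lines and half-planes of the complex plane, indexed by the
   angle theta, given by a real function h. *)
Definition line (R : realType) (h : R -> R) (theta : R) : set R[i] :=
  [set mu | complex.Re (cis theta * mu) = h theta].

Definition half_plane (R : realType) (h : R -> R) (theta : R) : set R[i] :=
  [set mu | complex.Re (cis theta * mu) <= h theta].

(* mu is a point where line h theta touches the envelope of the family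
   line h: mu satisfies both the equation of the line and the equation
   differentiated with respect to theta. The derivative of h is required to
   exist. *)
Definition tangency_point (R : realType) (h : R -> R) (theta : R)
    (mu : R[i]) : Prop :=
  line h theta mu /\
  exists d : R, is_derive theta 1 (fun t : R => complex.Re (cis t * mu)) d /\
                is_derive theta 1 h d.

Definition envelope (R : realType) (h : R -> R) : set R[i] :=
  [set mu | exists2 theta : R, 0 <= theta < 2 * pi &
                               tangency_point h theta mu].

Definition kippenhahn_curve (R : realType) (n : nat) (A : 'M[R[i]]_n) :
    set R[i] :=
  \bigcup_(k in [set k : nat | (1 <= k <= n)%N]) envelope (lambda A k).

Definition gamma_param (R : realType) (n : nat) (A : 'M[R[i]]_n)
    (z : R -> 'cV[R[i]]_n) (theta : R) : R[i] :=
  inner (A *m z theta) (z theta).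

Definition gamma (R : realType) (n : nat) (A : 'M[R[i]]_n)
    (z : R -> 'cV[R[i]]_n) : set R[i] :=
  [set mu | exists2 theta : R, 0 <= theta <= 2 * pi &
                               mu = gamma_param A z theta].

(* R[i]^o is R[i] with the topology given by its norm. *)
Definition closed_curve (R : realType) (p : R -> R[i]) : Prop :=
  {within `[0, 2 * pi], continuous (p : R -> R[i]^o)} /\ p 0 = p (2 * pi).

Definition boundary (R : realType) (S : set R[i]) : set R[i] :=
  closure (S : set R[i]^o) `\` interior (S : set R[i]^o).

(* Main.v *)
(* A point mu satisfies all the half-plane inequalities for Lambda_k(A) iff, for
   B = A - mu, every Re(e^{it} B) is nonnegative on some k-dimensional space; one needs
   a k-dimensional space on which the form of B itself vanishes. If some x <> 0 has
   <B x, x> = 0 while B x and B^* x are dependent, one can pass to a complement of x in a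
   space of smaller dimension and lose only one from k. Otherwise B is congruent to a
   diagonal matrix with nonzero entries, no two of which are antipodal. Sort these
   entries by the slopes t_j of their lines with respect to a half-plane through 0
   containing the least possible number p >= k of them. As a half-plane rotates by pi, the
   number of entries it contains walks from p to n - p by unit steps, and stays between
   these values. The steps crossing one level alternate in direction and are odd in
   number, say 2r+1, and the r's add up to p. Since
   sum_j t_j^m / prod_{l <> j} (t_j - t_l) = 0 for m <= 2r - 1 and the denominators
   alternate in sign too, each such chain carries an isotropic space of dimension r,
   spanned by vectors of the form (w_j t_j^q)_j with q < r.

   For the envelope, put L(t) = Re(e^{it} A), so that
   L(t + h) = cos h L(t) + sin h L(t + pi/2). The Courant-Fischer inequalities give
   lambda_k(t + h) = cos h lambda_k(t) + sin h <L(t + pi/2) z, z> + O(sin^2 h), where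
   the constant depends only on the spectral gap and on A. Hence
   lambda_k'(t) = <L(t + pi/2) z, z>, which says that the point of tangency is <A z, z>;
   using the expansion both at t and at t + h shows that lambda_k' is continuous. Finally
   lambda_k(t + pi) = - lambda_{n+1-k}(t), so only k <= (n+1)/2 matter. *)
Require Import Defs.
From HB Require Import structures.
From mathcomp Require Import all_boot all_order all_algebra.
From mathcomp Require Import complex.
From mathcomp Require Import all_classical all_reals all_analysis.
From mathcomp Require Import ring lra zify perm.
Set Implicit Arguments.
Unset Strict Implicit.
Unset Printing Implicit Defensive.
Import Order.TTheory GRing.Theory Num.Theory.
Import numFieldNormedType.Exports.
Local Open Scope ring_scope.
Local Open Scope sesquilinear_scope.

(** * Isotropic subspaces *)

Section Sesquilinear.
Variable C : numClosedFieldType.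

Lemma trmxC_mul m n p (A : 'M[C]_(m, n)) (B : 'M[C]_(n, p)) :
  (A *m B)^t* = B^t* *m A^t*.
Proof. by rewrite trmx_mul map_mxM. Qed.

Lemma trmxCD m n (A B : 'M[C]_(m, n)) : (A + B)^t* = A^t* + B^t*.
Proof. by apply/matrixP=> i j; rewrite !mxE rmorphD. Qed.

Lemma trmxCZ m n (a : C) (A : 'M[C]_(m, n)) : (a *: A)^t* = a^* *: A^t*.
Proof. by apply/matrixP=> i j; rewrite !mxE rmorphM. Qed.

(* Vectors are rows: for a column z, <A z, z> is sesq A z^* z^*. *)
Definition sesq n (A : 'M[C]_n) (v w : 'rV[C]_n) : C := (v *m A *m w^t*) 0 0.

Lemma sesqDl n (A : 'M[C]_n) (v v' w : 'rV[C]_n) : sesq A (v + v') w = sesq A v w + sesq A v' w.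
Proof. by rewrite /sesq !mulmxDl mxE. Qed.

Lemma sesqDr n (A : 'M[C]_n) (v w w' : 'rV[C]_n) : sesq A v (w + w') = sesq A v w + sesq A v w'.
Proof. by rewrite /sesq trmxCD mulmxDr mxE. Qed.

Lemma sesqZl n (A : 'M[C]_n) (a : C) (v w : 'rV[C]_n) : sesq A (a *: v) w = a * sesq A v w.
Proof. by rewrite /sesq -!scalemxAl mxE. Qed.

Lemma sesqZr n (A : 'M[C]_n) (a : C) (v w : 'rV[C]_n) : sesq A v (a *: w) = a^* * sesq A v w.
Proof. by rewrite /sesq trmxCZ -scalemxAr mxE. Qed.

Lemma sesq_comb n (A : 'M[C]_n) (a b : C) (v w : 'rV[C]_n) :
  sesq A (a *: v + b *: w) (a *: v + b *: w) =
  (a * a^* ) * sesq A v v + (b * b^* ) * sesq A w w +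
  ((a * b^* ) * sesq A v w + (b * a^* ) * sesq A w v).
Proof. by rewrite sesqDl !sesqDr !sesqZl !sesqZr; ring. Qed.

Lemma sesqJ n (A : 'M[C]_n) (v w : 'rV[C]_n) : (sesq A v w)^* = sesq (A^t*) w v.
Proof.
have -> : (sesq A v w)^* = ((v *m A *m w^t*)^t*) 0 0.
  by rewrite [RHS]mxE; congr (_^* ); rewrite mxE.
by rewrite !trmxC_mul trmxCK mulmxA.
Qed.

Lemma sesq_mul m n (A : 'M[C]_n) (Q : 'M[C]_(m, n)) (v w : 'rV[C]_m) :
  sesq A (v *m Q) (w *m Q) = sesq (Q *m A *m Q^t*) v w.
Proof. by rewrite /sesq trmxC_mul !mulmxA. Qed.

Lemma sesqMl n (a : C) (A : 'M[C]_n) (v w : 'rV[C]_n) : sesq (a *: A) v w = a * sesq A v w.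
Proof. by rewrite /sesq -scalemxAr -scalemxAl mxE. Qed.

Lemma sesq_matD n (A B : 'M[C]_n) (v w : 'rV[C]_n) : sesq (A + B) v w = sesq A v w + sesq B v w.
Proof. by rewrite /sesq mulmxDr mulmxDl mxE. Qed.

Lemma isotropic_sub m p n (A : 'M[C]_n) (V : 'M[C]_(m, n)) (W : 'M[C]_(p, n)) :
  V *m A *m V^t* = 0 -> (W <= V)%MS -> W *m A *m W^t* = 0.
Proof.
move=> iV /submxP[D ->]; rewrite trmxC_mul.
have -> : D *m V *m A *m (V^t* *m D^t*) = D *m (V *m A *m V^t*) *m D^t*.
  by rewrite !mulmxA.
by rewrite iV mulmx0 mul0mx.
Qed.

Definition isotropic k n (A : 'M[C]_n) :=
  exists V : 'M[C]_n, (k <= \rank V)%N /\ V *m A *m V^t* = 0.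

(* F spans the finitely many exceptional directions produced by passing to a
   space of smaller dimension in isotropic_reduce. *)
Definition halfplane_cond k n (A : 'M[C]_n) :=
  exists2 F : seq C, 0 \notin F &
  forall u : C, u != 0 -> all (fun f => u * f^* \isn't Num.real) F ->
  exists V : 'M[C]_n, (k <= \rank V)%N /\
    forall v : 'rV[C]_n, (v <= V)%MS -> 0 <= 'Re (u * sesq A v v).

Lemma isotropic_gen k m n (A : 'M[C]_n) (V : 'M[C]_(m, n)) :
  (k <= \rank V)%N -> V *m A *m V^t* = 0 -> isotropic k A.
Proof.
move=> rV iV; exists <<V>>%MS; rewrite genmxE; split=> //.
by apply: isotropic_sub iV _; rewrite genmxE.
Qed.

(* By the dependency, the conditions x A w^* = 0 and w A x^* = 0 cut out a subspace
   of codimension at most one. *)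
Definition reducing n (A : 'M[C]_n) (x : 'rV[C]_n) :=
  [/\ x != 0, sesq A x x = 0 & exists a b : C, ((a != 0) || (b != 0)) /\
       a *: (x *m A) + b *: (x *m A^t*) = 0].

Lemma mx11_eq0 (M : 'M[C]_1) : M 0 0 = 0 -> M = 0.
Proof. by move=> h; apply/matrixP=> i j; rewrite !ord1 h mxE. Qed.

Lemma sub_kermx_rV m n (y : 'M[C]_(m, n)) (w : 'rV[C]_m) :
  (w <= kermx y)%MS = (w *m y == 0).
Proof. by apply/sub_kermxP/eqP. Qed.

(* Otherwise the values of the form at v + c x, which are affine in c, would be
   unbounded below. *)
Lemma nonneg_radical n (A : 'M[C]_n) (V : 'M[C]_n) (x v : 'rV[C]_n) (u : C) :
  (forall v : 'rV[C]_n, (v <= V)%MS -> 0 <= 'Re (u * sesq A v v)) ->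
  (x <= V)%MS -> (v <= V)%MS -> sesq A x x = 0 ->
  u * sesq A x v + (u * sesq A v x)^* = 0.
Proof.
move=> nnV xV vV x0; set z := (X in X = 0).
have lin (c : C) : 0 <= 'Re (u * sesq A v v) + 'Re (c * z).
  have := nnV (v + c *: x) (addmx_sub vV (scalemx_sub _ xV)).
  rewrite !sesqDl !sesqDr !sesqZl !sesqZr x0 !mulr0 addr0 /z.
  set p := sesq A v v; set q := sesq A v x; set r := sesq A x v.
  suff -> : 'Re (u * (p + c^* * q + c * r)) = 'Re (u * p) + 'Re (c * (u * r + (u * q)^*)) by [].
  rewrite mulrDr raddfD /= mulrDr raddfD /= mulrDr raddfD /= -addrA.
  congr (_ + _); rewrite addrC; congr (_ + _); first by rewrite mulrCA.
  by rewrite -[RHS]Re_conj rmorphM /= conjCK mulrCA.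
set p := 'Re (u * _) in lin.
apply/eqP/negPn/negP => z0.
have pr : p \is Num.real by apply: Creal_Re.
have := lin (- (p + 1) / z); rewrite divfK //.
rewrite (Creal_ReP _ _); last by rewrite rpredN rpredD // rpred1.
by rewrite opprD addrA subrr add0r oppr_ge0 ler10.
Qed.

(** The equation gives u = w u^* with w = - b / a, so its nonzero solutions lie on one real line
    through 0, spanned by f. A reduction step has to exclude these directions. *)
Lemma bad_line (a b : C) : (a != 0) || (b != 0) ->
  exists2 f : C, f != 0 &
    forall u : C, u != 0 -> u * a + u^* * b = 0 -> u * f^* \is Num.real.
Proof.
move=> ab; pose w := - b / a.
have wE u : u != 0 -> u * a + u^* * b = 0 -> u = w * u^*.
  move=> u0 h; have a0 : a != 0.
    apply/negP => /eqP a0; move: ab h; rewrite a0 eqxx mulr0 add0r /= => b0 /eqP.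
    by rewrite mulf_eq0 conjC_eq0 (negbTE u0) (negbTE b0).
  apply: (mulIf a0); rewrite (eqP (_ : u * a == - (u^* * b))) -?addr_eq0 ?h //.
  by rewrite /w mulrAC divfK // mulNr mulrC.
clearbody w.
(* From u = w u^* it follows that u times the conjugate of 1 + w is u + u^*, which is real. For w =
   -1 that direction degenerates to 0, but then u is purely imaginary. *)
have [w1|w1] := eqVneq w (-1).
  exists 'i; rewrite ?neq0Ci // => u u0 /(wE _ u0); rewrite w1 mulN1r => h.
  by apply/CrealP; rewrite rmorphM /= conjCK conjCi {2}h mulrNN.
exists (1 + w); first by rewrite addrC -[1]opprK subr_eq0.
move=> u u0 /(wE _ u0) h; apply/CrealP.
rewrite rmorphM /= conjCK rmorphD rmorph1 !mulrDr !mulr1 [u^* * w]mulrC -h addrC; congr (_ + _).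
by rewrite {1}h rmorphM /= conjCK mulrC.
Qed.

End Sesquilinear.

(** * Reduction to smaller spaces and diagonalisation by congruence *)

Section Reduction.
Variable C : numClosedFieldType.

Lemma rank_adds_notin m n (T : 'M[C]_(m, n)) (x : 'rV[C]_n) :
  ~~ (x <= T)%MS -> (\rank T < \rank (T + x)%MS)%N.
Proof.
move=> xT; rewrite ltn_neqAle mxrankS ?addsmxSl // andbT.
apply: contra xT => /eqP e; have := addsmxSl T x.
by case/mxrank_leqif_sup => _; rewrite e eqxx => /esym h; apply: submx_trans (addsmxSr T x) h.
Qed.

(** With both rows multiples of one row [y], orthogonality to [y] alone implies both conditions
    needed to split off [x]. *)
Lemma reducing_common n (A : 'M[C]_n) x : reducing A x ->
  exists y : 'rV[C]_n, exists a b : C,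
    [/\ (a != 0) || (b != 0), x *m A = a *: y & x *m A^t* = b *: y].
Proof.
case=> _ _ [a [b [ab e]]]; have [a0|a0] := eqVneq a 0.
  move: ab e; rewrite a0 eqxx /= scale0r add0r => b0 /eqP.
  rewrite scaler_eq0 (negbTE b0) /= => /eqP e.
  by exists (x *m A), 1, 0; rewrite oner_neq0 scale1r scale0r.
exists (x *m A^t*), (- (a^-1 * b)), 1; rewrite oner_neq0 orbT scale1r; split=> //.
have e' : a *: (x *m A) = - (b *: (x *m A^t*)) by apply/eqP; rewrite -addr_eq0 e.
by rewrite -[LHS]scale1r -(mulVf a0) -scalerA e' scalerN scalerA scaleNr.
Qed.

(** The orthogonal complement W of [y] contains [x], and the form vanishes between [x] and W on both
    sides. Hence an isotropic space in a complement W' of [x] inside W stays isotropic when [x] is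
    added, which regains the dimension lost. *)
Lemma isotropic_reduce n k (A : 'M[C]_n) (x : 'rV[C]_n) :
  reducing A x -> halfplane_cond k.+1 A ->
  (forall m (B : 'M[C]_m), (m < n)%N -> halfplane_cond k B -> isotropic k B) ->
  isotropic k.+1 A.
Proof.
move=> redx [F F0 hF] IH.
have [x0 xx _] := redx; have [y [a [b [ab xA xAt]]]] := reducing_common redx.
pose W := kermx (y^t*).
have Wy m (P : 'M[C]_(m, n)) : (P <= W)%MS -> P *m y^t* = 0 by move/sub_kermxP.
have WxA m (P : 'M[C]_(m, n)) : (P <= W)%MS -> x *m A *m P^t* = 0.
  move=> /Wy h; rewrite xA -scalemxAl -[y]trmxCK -trmxC_mul h.
  by apply/matrixP => i j; rewrite !mxE conjC0 mulr0.
have WAx m (P : 'M[C]_(m, n)) : (P <= W)%MS -> P *m A *m x^t* = 0.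
  move=> /Wy h; rewrite -mulmxA -[A]trmxCK -trmxC_mul xAt trmxCZ -scalemxAr h.
  by rewrite scaler0.
have xW : (x <= W)%MS.
  rewrite sub_kermx_rV; case/orP: ab => c0.
    have : x *m (a *: y)^t* == 0.
      by rewrite -xA trmxC_mul mulmxA; apply/eqP/mx11_eq0; rewrite -[LHS]sesqJ xx conjC0.
    by rewrite trmxCZ -scalemxAr scaler_eq0 conjC_eq0 (negbTE c0).
  have : x *m (b *: y)^t* == 0.
    by rewrite -xAt trmxC_mul trmxCK mulmxA; apply/eqP/mx11_eq0.
  by rewrite trmxCZ -scalemxAr scaler_eq0 conjC_eq0 (negbTE c0).
pose W' := (W :\: x)%MS; pose m := \rank W'; pose Q := row_base W'.
have rW : \rank W = m.+1.
  rewrite /m /W' -(mxrank_cap_compl W x) capmxC (capmx_idPl xW).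
  by rewrite rank_rV x0 add1n.
have mn : (m < n)%N by rewrite -rW rank_leq_col.
have W'W : (W' <= W)%MS by apply: diffmxSl.
have W'x : (W' :&: x)%MS = 0 by apply: capmx_diff.
have rWn : (n <= (\rank W).+1)%N.
  by rewrite mxrank_ker; have := rank_leq_col (y^t*); lia.
have [Z [rZ iZ]] : isotropic k (Q *m A *m Q^t*).
  apply: IH mn _.
  have [f f0 fP] := bad_line ab.
  exists (f :: F); first by rewrite inE negb_or eq_sym f0.
  move=> u u0 /= /andP[uf /(hF u u0)[V [rV nnV]]].
  pose T := (V :&: W)%MS; pose S := ((T + x) :&: W')%MS.
  (* If x is not in T, it makes up for the dimension lost by cutting V with W. If x is in T, then
     [nonneg_radical] and the choice of u off the exceptional line force all of V into W. *)
  have rTx : (k.+1 <= \rank (T + x)%MS)%N.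
    have [xT|xT] := boolP (x <= T)%MS; last first.
      apply: leq_trans (rank_adds_notin xT); rewrite ltnS /T.
      move: (mxrank_sum_cap V W) (rank_leq_col (V + W)%MS) rWn rV.
      move: (\rank (V + W)%MS) (\rank (V :&: W)%MS) (\rank V) (\rank W).
      by clear => a b c d; lia.
    apply: leq_trans (mxrankS (addsmxSl _ _)); apply: leq_trans rV _.
    apply: mxrankS; rewrite sub_capmx submx_refl /=.
    apply/row_subP => i; set v := row i V.
    have vV : (v <= V)%MS by apply: row_sub.
    have xV : (x <= V)%MS by move: xT; rewrite sub_capmx => /andP[].
    have := nonneg_radical nnV xV vV xx.
    have -> : sesq A x v = a * (y *m v^t*) 0 0 by rewrite /sesq xA -scalemxAl mxE.
    rewrite rmorphM /= sesqJ.
    have -> : sesq (A^t*) x v = b * (y *m v^t*) 0 0 by rewrite /sesq xAt -scalemxAl mxE.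
    rewrite !mulrA -mulrDl => /eqP; rewrite mulf_eq0 => /orP[/eqP /(fP u u0)|].
      by rewrite (negbTE uf).
    move=> /eqP /mx11_eq0 h; rewrite sub_kermx_rV -[v]trmxCK -trmxC_mul h.
    by apply/eqP/matrixP => ? ?; rewrite !mxE conjC0.
  have rS : (k <= \rank S)%N.
    have := mxrank_sum_cap (T + x)%MS W'.
    have : (\rank (T + x + W')%MS <= m.+1)%N.
      by rewrite -rW mxrankS // !addsmx_sub capmxSr xW W'W.
    rewrite -/S -/m => hm e.
    have arith : forall i a b c d : nat,
        (i < c -> a <= d.+1 -> a + b = c + d -> i <= b)%N by clear; lia.
    exact: arith rTx hm e.
  have SQ : S *m pinvmx Q *m Q = S by apply: mulmxKpV; rewrite eq_row_base capmxSr.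
  exists <<S *m pinvmx Q>>%MS; split.
    rewrite genmxE; apply: leq_trans rS _; rewrite -[X in (\rank X <= _)%N]SQ.
    exact: mxrankM_maxl.
  move=> c; rewrite genmxE => /(submxMr Q); rewrite SQ -sesq_mul.
  move=> /submx_trans/(_ (capmxSl _ _))/sub_addsmxP[[c1 c2] /= ->].
  set t := c1 *m T; have tT : (t <= T)%MS by apply: submxMl.
  have tW : (t <= W)%MS by apply: submx_trans tT (capmxSr _ _).
  have -> : c2 *m x = c2 0 0 *: x by rewrite [c2]mx11_scalar mul_scalar_mx mxE.
  (* At a vector t plus a multiple of x the form takes its value at t, and t lies in V. *)
  rewrite !sesqDl !sesqDr !sesqZl !sesqZr xx.
  have -> : sesq A t x = 0 by rewrite /sesq WAx // mxE.
  have -> : sesq A x t = 0 by rewrite /sesq WxA // mxE.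
  by rewrite !mulr0 !addr0; apply: nnV; apply: submx_trans tT (capmxSl _ _).
pose P := Z *m Q.
have PW' : (P <= W')%MS by rewrite -(eq_row_base W') submxMl.
have PW : (P <= W)%MS by apply: submx_trans PW' W'W.
apply: (isotropic_gen (V := col_mx P x)).
  rewrite -addsmxE; apply: leq_ltn_trans (rank_adds_notin _).
    by rewrite mxrankMfree ?row_base_free.
  apply: contra x0 => xP; rewrite -submx0 -W'x sub_capmx submx_refl andbT.
  exact: submx_trans xP PW'.
rewrite tr_col_mx map_row_mx mul_col_mx mul_col_row WAx // WxA //.
have -> : P *m A *m P^t* = 0.
  have -> : P *m A *m P^t* = Z *m (Q *m A *m Q^t*) *m Z^t*.
    by rewrite /P trmxC_mul !mulmxA.
  exact: iZ.
have -> : x *m A *m x^t* = 0 by apply: mx11_eq0.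
by rewrite /block_mx !row_mx0 col_mx0.
Qed.

Lemma diag_mx11 (M : 'M[C]_1) : diag_mx M = M.
Proof. by apply/matrixP => i j; rewrite !ord1 mxE eqxx mulr1n. Qed.

(** A kernel vector would be reducing, so A is invertible. An eigenvector x of A times the inverse
    of its adjoint has x A proportional to x A^*, hence a nonzero value of the form, and vectors
    orthogonal to x on one side are so on the other. Thus x splits off and induction applies. *)
Lemma congruent_diag n (A : 'M[C]_n) : (forall x, ~ reducing A x) ->
  exists Q : 'M[C]_n, exists d : 'rV[C]_n, row_free Q /\ Q *m A *m Q^t* = diag_mx d.
Proof.
elim: n A => [|n IH] A noA.
  by exists 1%:M, 0; split; [rewrite row_free_unit unitmx1 | apply/matrixP => [[]]].
have fA : A \in unitmx.
  rewrite -row_free_unit -kermx_eq0; apply/negPn/negP => /rowV0Pn[x xA x0].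
  apply: (noA x); move/sub_kermxP: xA => xA.
  split=> //; first by rewrite /sesq xA mul0mx mxE.
  by exists 1, 0; rewrite oner_neq0 xA scaler0 scale0r addr0.
have fAt : A^t* \in unitmx by rewrite map_unitmx unitmx_tr.
have [z /eigenvalueP[x xE x0]] := eigenvalue_closed (A *m invmx (A^t*)) isT.
have xA : x *m A = z *: (x *m A^t*).
  by rewrite scalemxAl -xE mulmxA mulmxKV.
have xx : sesq A x x != 0.
  apply/negP => /eqP xx; apply: (noA x); split=> //.
  by exists 1, (- z); rewrite oner_neq0 xA scale1r scaleNr subrr.
pose W := kermx (A *m x^t*); pose Q := row_base W.
have WAx m (P : 'M[C]_(m, n.+1)) : (P <= W)%MS -> P *m A *m x^t* = 0.
  by move/sub_kermxP; rewrite mulmxA.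
have WxA m (P : 'M[C]_(m, n.+1)) : (P <= W)%MS -> x *m A *m P^t* = 0.
  move=> /WAx h; rewrite xA -scalemxAl -[x]trmxCK -trmxC_mul -[P]trmxCK.
  rewrite -trmxC_mul trmxCK mulmxA h.
  by apply/matrixP => i j; rewrite !mxE conjC0 mulr0.
have xW : ~~ (x <= W)%MS.
  apply/negP => /WAx h; move: xx; rewrite /sesq h mxE eqxx //.
have rW : \rank W = n.
  rewrite mxrank_ker -[A]trmxCK -trmxC_mul mxrank_map mxrank_tr mxrankMfree ?row_free_unit //.
  by rewrite rank_rV x0 subSS subn0.
have [Q0 [fQ0 Q0W]] : exists Q : 'M[C]_(n, n.+1), row_free Q /\ (Q <= W)%MS.
  have gen r : r = \rank W -> exists Q : 'M[C]_(r, n.+1), row_free Q /\ (Q <= W)%MS.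
    by move=> ->; exists (row_base W); rewrite row_base_free eq_row_base.
  exact: gen.
have rank1 (Q1 : 'M[C]_(n, n.+1)) : row_free Q1 -> (Q1 <= W)%MS ->
    row_free (col_mx x Q1 : 'M[C]_n.+1).
  move=> /eqP fQ1 Q1W; have xQ1 : ~~ (x <= Q1)%MS.
    by apply: contra xW => /submx_trans; apply.
  have := rank_adds_notin xQ1; rewrite addsmxC (addsmxE x Q1) fQ1 => h.
  by rewrite /row_free eqn_leq rank_leq_row.
have [|Q1 [d [fQ1 dE]]] := IH (Q0 *m A *m Q0^t*).
  move=> y [y0 yy [a [b [ab e]]]]; apply: (noA (y *m Q0)); split.
  - by apply: contra y0; rewrite mulmx_free_eq0.
  - by rewrite sesq_mul.
  (* The row r is orthogonal to the rows of Q0 by assumption and to x by the choice of W. Together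
     these form a basis, so r = 0. *)
  exists a, b; split=> //; set r := (X in X = 0).
  have rU : r *m (col_mx x Q0)^t* = 0.
    rewrite tr_col_mx map_row_mx mul_mx_row.
    have -> : r *m Q0^t* = 0.
      rewrite -e /r mulmxDl -!scalemxAl !trmxC_mul trmxCK !mulmxA; congr (_ + _).
    have -> : r *m x^t* = 0; last by rewrite row_mx0.
    rewrite /r mulmxDl -!scalemxAl.
    rewrite -!mulmxA [Q0 *m (A *m _)]mulmxA WAx // mulmx0 scaler0 add0r.
    rewrite -[Q0]trmxCK -!trmxC_mul WxA // trmx0 map_mx0 mulmx0 scaler0 //.
  have := rank1 _ fQ0 Q0W; rewrite row_free_unit => U.
  have Ut : (col_mx x Q0 : 'M[C]_n.+1)^t* \in unitmx by rewrite map_unitmx unitmx_tr.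
  by rewrite -(mulmxK Ut r) [X in X *m _](rU) mul0mx.
have Q10W : (Q1 *m Q0 <= W)%MS by apply: submx_trans Q0W; apply: submxMl.
exists (col_mx x (Q1 *m Q0)), (row_mx (x *m A *m x^t*) d); split.
  by apply: rank1 => //; rewrite /row_free mxrankMfree.
suff : col_mx x (Q1 *m Q0) *m A *m (col_mx x (Q1 *m Q0))^t* =
       diag_mx (row_mx (x *m A *m x^t*) d) by [].
rewrite tr_col_mx map_row_mx mul_col_mx mul_col_row (WAx _ (Q1 *m Q0)) // (WxA _ (Q1 *m Q0)) // diag_mx_row diag_mx11.
by rewrite -dE trmxC_mul !mulmxA.
Qed.

End Reduction.

(** * Alternating chains *)

Section Levels.
Variables (T : eqType) (e : pred T).
Implicit Types s : seq T.

(* A walk which starts at height a + count e s, where a steps outside e have been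
   made before, goes down at the elements of e and up at the others. The level
   of a step is the lower of its two heights. *)
Fixpoint levels (a : nat) s : seq nat :=
  if s is x :: s' then (a + count e s')%N :: levels (a + ~~ e x)%N s' else [::].

Lemma size_levels a s : size (levels a s) = size s.
Proof. by elim: s a => //= x s IH a; rewrite IH. Qed.

Lemma levels_exists s : uniq s -> exists lev : T -> nat, map lev s = levels 0 s.
Proof.
move=> us; case: s us => [|x0 s'] us; first by exists (fun=> 0%N).
set s := x0 :: s' in us *.
exists (fun i => nth 0%N (levels 0 s) (index i s)).
apply: (@eq_from_nth _ 0%N); rewrite size_map ?size_levels // => j js.
by rewrite (nth_map x0) // index_uniq.
Qed.

Lemma levels_cat a s1 x s2 :
  nth 0%N (levels a (s1 ++ x :: s2)) (size s1) =
  (a + count (predC e) s1 + count e s2)%N.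
Proof.
elim: s1 a => [|y s1 IH] a /=; first by rewrite addn0.
by rewrite IH addnA.
Qed.

Lemma level_alternates (lev : T -> nat) u a s : map lev s = levels a s ->
  path (fun b c : bool => b != c) (~~ (u < a + count e s)%N)
    (map e [seq i <- s | lev i == u]).
Proof.
elim: s a => [|x s IH] a //= [lx /IH]; rewrite lx => {IH}.
have shift b b' l : b = b' -> path (fun b c : bool => b != c) (~~ b) l ->
    path (fun b c : bool => b != c) (~~ b') l by move=> ->.
case ex: (e x) => IH; case: eqP => [lu|lu] /=; last 1 first.
- by apply: shift IH; lia.
- rewrite ex; have -> : (u < a + (true + count e s))%N = true by lia.
  by rewrite /= (shift _ false _ _ IH) //; lia.
- by apply: shift IH; lia.
rewrite ex; have -> : (u < a + (false + count e s))%N = false by lia.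
by rewrite /= (shift _ true _ _ IH) //; lia.
Qed.

(** Each step at level u changes the side of the level, so only the start and the end of the walk
    matter; its final height is [a + count (predC e) s]. *)
Lemma level_parity (lev : T -> nat) u a s : map lev s = levels a s ->
  odd (size [seq i <- s | lev i == u]) =
  (u < a + count e s)%N (+) (u < a + count (predC e) s)%N.
Proof.
elim: s a => [|x s IH] a //=; first by rewrite addbb.
move=> [lx /IH]; rewrite lx => {}IH.
by case ex: (e x) IH => /= IH; case: eqP => [lu|lu]; rewrite /= IH; lia.
Qed.

Lemma sum_levels (lo hi : nat) (ls : seq nat) :
  all (fun l => (lo <= l < hi)%N) ls ->
  (\sum_(lo <= u < hi) count_mem u ls = size ls)%N.
Proof.
elim: ls => [|l ls IH] /=; first by rewrite big1.
move=> /andP[/andP[h1 h2] /IH <-]; rewrite big_split /= -[RHS]add1n; congr (_ + _)%N.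
rewrite (bigD1_seq l) ?iota_uniq ?mem_index_iota ?h1 //= eqxx big1 // => i.
by rewrite eq_sym => /negbTE ->.
Qed.

End Levels.

Lemma avoid_below (R : rcfType) (L : seq R) (t : R) :
  exists2 tau, tau < t & forall x, x \in L -> ~~ (tau <= x < t).
Proof.
elim: L => [|y L [tau h1 h2]]; first by exists (t - 1); rewrite ?ltrBlDr ?ltrDl.
have [ty|yt] := leP t y.
  exists tau => // x; rewrite inE => /orP[/eqP ->|/h2 //].
  by rewrite (ltNge y) ty andbF.
exists (Num.max tau ((y + t) / 2)); first by rewrite gt_max h1; lra.
move=> x; rewrite inE ge_max => /orP[/eqP ->|/h2].
  by rewrite negb_and; apply/orP; left; rewrite negb_and; apply/orP; right; lra.
by apply: contra => /andP[/andP[-> _] ->].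
Qed.

Lemma avoid_above (R : rcfType) (L : seq R) (t : R) :
  exists2 tau, t < tau & forall x, x \in L -> ~~ (t < x <= tau).
Proof.
have [tau h1 h2] := avoid_below [seq - x | x <- L] (- t).
exists (- tau); first by rewrite ltrNr.
move=> x xL; have := h2 (- x); rewrite map_f // => /(_ isT).
by rewrite ltrN2 lerNr andbC.
Qed.

(** The sum is the coefficient of degree |c| - 1 in the Lagrange interpolation polynomial of P at
    the points t i. That polynomial is P itself, whose degree is smaller. *)
Lemma lagrange_sum (K : fieldType) (T : eqType) (t : T -> K) (c : seq T) (P : {poly K}) :
  uniq c -> {in c &, injective t} -> (size P < size c)%N ->
  \sum_(i <- c) P.[t i] / \prod_(l <- c | l != i) (t i - t l) = 0.
Proof.
move=> uc tinj sP.
have tne i l : i \in c -> l \in c -> l != i -> t i - t l != 0.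
  by move=> ic lc; apply: contra; rewrite subr_eq0 => /eqP /(tinj _ _ ic lc) ->.
pose B i : {poly K} := \prod_(l <- c | l != i) ('X - (t l)%:P).
have BE i : B i = \prod_(y <- [seq t l | l <- c & l != i]) ('X - y%:P).
  by rewrite big_map big_filter.
have sc i : i \in c -> size [seq t l | l <- c & l != i] = (size c).-1.
  move=> ic; rewrite size_map size_filter.
  have := count_predC (pred1 i) c; rewrite count_uniq_mem // ic.
  by rewrite (eq_count (a2 := predC (pred1 i))) //=; lia.
pose w i := \prod_(l <- c | l != i) (t i - t l).
pose Q : {poly K} := \sum_(i <- c) (P.[t i] / w i) *: B i.
have QP : Q = P.
  apply/eqP; rewrite -subr_eq0; apply/negPn/negP => QP0.
  have sQ : (size (Q - P)%R <= size c)%N.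
    apply: leq_trans (size_polyD _ _) _; rewrite geq_max size_polyN (ltnW sP) andbT.
    rewrite /Q big_seq; apply: (big_ind (fun q : {poly K} => size q <= size c)%N).
    - by rewrite size_poly0.
    - by move=> p q hp hq; apply: leq_trans (size_polyD _ _) _; rewrite geq_max hp.
    move=> i ic; apply: leq_trans (size_scale_leq _ _) _.
    rewrite BE size_prod_XsubC sc // prednK //.
    by case: (c) ic.
  have := max_poly_roots (rs := map t c) QP0; rewrite size_map map_inj_in_uniq // uc.
  rewrite ltnNge sQ => h.
  suff : all (root (Q - P)) (map t c) by move/h/(_ isT).
  apply/allP => _ /mapP[j jc ->]; apply/rootP.
  rewrite hornerD hornerN; apply/eqP; rewrite subr_eq0; apply/eqP.
  rewrite /Q horner_sum (bigD1_seq j) //= [X in _ + X]big_seq_cond big1 ?addr0.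
    rewrite hornerZ /B horner_prod.
    under eq_bigr do rewrite hornerXsubC.
    rewrite -/(w j) divfK //.
    rewrite /w big_seq_cond; apply: (big_ind (fun x => x != 0)).
    - exact: oner_neq0.
    - by move=> x y hx hy; rewrite mulf_neq0.
    by move=> l /andP[lc lj]; apply: tne.
  move=> i /andP[ic ij]; rewrite hornerZ (_ : (B i).[t j] = 0) ?mulr0 //.
  by apply/rootP; rewrite BE root_prod_XsubC map_f // mem_filter eq_sym ij.
have : Q`_(size c).-1 = 0.
  by rewrite QP nth_default // -ltnS (ltn_predK sP).
rewrite coef_sum => Q0; rewrite -[RHS]Q0; apply: eq_big_seq => i ic.
rewrite coefZ BE; have := monic_prod_XsubC [seq t l | l <- c & l != i] xpredT id.
rewrite monicE /lead_coef size_prod_XsubC sc // => /eqP ->.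
by rewrite mulr1.
Qed.

Section Chains.
Variables (R : rcfType) (T : eqType) (t : T -> R) (e : pred T).

Definition eps (i : T) : R := if e i then 1 else -1.

Lemma eps_sqr i : eps i * eps i = 1.
Proof. by rewrite /eps; case: (e i); rewrite ?mulrNN mulr1. Qed.

Lemma eps_last x c : path (fun y z => e y != e z) x c ->
  eps (last x c) = (-1) ^+ size c * eps x.
Proof.
elim: c x => [|y c IH] x /=; first by rewrite mul1r.
move=> /andP[xy /IH ->]; rewrite exprS -mulrA mulrCA; congr (_ * _).
by move: xy; rewrite /eps; case: (e x); case: (e y) => // _; rewrite ?mulrNN mulr1.
Qed.

Lemma prod_below_sign x c : all (fun y => t x < t y) c ->
  0 < (-1) ^+ size c * \prod_(l <- c) (t x - t l).
Proof.
elim: c => [|y c IH] /=; first by rewrite big_nil mulr1.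
move=> /andP[xy /IH]; rewrite big_cons exprS => h.
have -> : -1 * (-1) ^+ size c * ((t x - t y) * \prod_(j <- c) (t x - t j)) =
    (t y - t x) * ((-1) ^+ size c * \prod_(l <- c) (t x - t l)) by ring.
by apply: mulr_gt0 => //; rewrite subr_gt0.
Qed.

(** One step along an increasing chain changes the sign of the product of differences, and also that
    of [eps]. So all signs agree with the one at the last element, where every difference is
    positive. *)
Lemma chain_sign x c : path (fun y z => t y < t z) x c ->
  path (fun y z => e y != e z) x c -> forall i, i \in x :: c ->
  0 < eps (last x c) * eps i * \prod_(l <- x :: c | l != i) (t i - t l).
Proof.
have ttr : transitive (fun y z => t y < t z) by move=> ? ? ?; apply: lt_trans.
elim: c x => [|y c IH] x xlt xne i.
  by rewrite inE => /eqP ->; rewrite big_cons eqxx /= big_nil mulr1 eps_sqr ltr01.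
have xall := order_path_min ttr xlt.
have xi j : j \in y :: c -> x != j.
  by move=> /(allP xall) /=; apply: contraTneq => <-; rewrite ltxx.
rewrite inE => /orP[/eqP ->|ic].
  rewrite big_cons eqxx /= (eps_last xne) big_seq_cond.
  rewrite (eq_bigl (fun j => j \in y :: c)); last first.
    by move=> j; rewrite andb_idr // => /xi; rewrite eq_sym.
  by rewrite -big_seq -[X in X * _]mulrA eps_sqr mulr1; apply: prod_below_sign.
rewrite big_cons (xi _ ic) mulrCA; apply: mulr_gt0.
  by rewrite subr_gt0; apply: (allP xall).
by apply: IH => //; [case/andP: xlt | case/andP: xne].
Qed.

Lemma chain_sorted_uniq c : sorted (fun y z => t y < t z) c -> uniq c /\ {in c &, injective t}.
Proof.
move=> sc; have um : uniq (map t c).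
  by apply: lt_sorted_uniq; rewrite sorted_map.
split; first exact: map_uniq um.
elim: c sc um => [|x c IH] //= /path_sorted sc /andP[xc um] i j.
rewrite !inE => /orP[/eqP ->|ic] /orP[/eqP ->|jc] //.
- by move=> h; move: xc; rewrite h map_f.
- by move=> h; move: xc; rewrite -h map_f.
exact: IH.
Qed.

End Chains.

(** * Isotropic spaces carried by alternating chains *)

Section ChainIsotropic.
Variables (R : rcfType) (C : numClosedFieldType) (rc : {rmorphism R -> C}).
Hypothesis rcJ : forall x, (rc x)^* = rc x.

Lemma chain_isotropic n (d : 'rV[C]_n) (u0 : C) (rho t : 'I_n -> R) (e : pred 'I_n) c r :
  (forall i, 0 < rho i) ->
  (forall i, d 0 i = u0 * (rc (eps R e i * rho i) * (1 + 'i * rc (t i)))) ->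
  sorted (fun y z => t y < t z) c -> sorted (fun y z => e y != e z) c ->
  (r.*2 < size c)%N ->
  exists V : 'M[C]_(r, n), [/\ row_free V, forall q i, i \notin c -> V q i = 0
    & V *m diag_mx d *m V^t* = 0].
Proof.
move=> rho0 dE tc ec rc2.
have [uc tinj] := chain_sorted_uniq tc.
pose w i := \prod_(l <- c | l != i) (t i - t l).
have [s sgn] : exists s : R, forall i, i \in c -> 0 < s * eps R e i * w i.
  by case: c tc ec @w {rc2 uc tinj} => [|x c] tc ec w; [exists 1 | exists (eps R e (last x c)) => i /(chain_sign tc ec)].
have w0 i : i \in c -> w i != 0.
  by move/sgn; apply: contraTneq => ->; rewrite mulr0 ltxx.
(* The weights g are positive by [chain_sign]. With the entries sqrt g_i t_i^q the form becomes a
   combination of sums of t_i^m / w_i. These vanish by [lagrange_sum], since m is at most 2 r - 1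
   and the chain has more than 2 r elements. *)
pose g i := s * eps R e i / (w i * rho i).
have g0 i : i \in c -> 0 < g i.
  move=> ic; rewrite /g invfM mulrA divr_gt0 //.
  have -> : s * eps R e i / w i = s * eps R e i * w i / (w i ^+ 2).
    by rewrite expr2 invfM mulrA mulfK // w0.
  by rewrite divr_gt0 ?sgn // exprn_even_gt0 //= w0.
pose V : 'M[C]_(r, n) := \matrix_(q, i) if i \in c then rc (Num.sqrt (g i) * t i ^+ q) else 0.
exists V; split.
(* A dependency between the rows is a polynomial with at most r coefficients which vanishes at more
   than 2 r points. *)
- rewrite -kermx_eq0; apply/negPn/negP => /rowV0Pn[v /sub_kermxP vV].
  move/negP; apply; pose p := rVpoly v.
  have pE i : i \in c -> p.[rc (t i)] = 0.
    move=> ic; have /matrixP/(_ 0 i) := vV; rewrite !mxE.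
    under eq_bigr => q _ do rewrite mxE ic rmorphM rmorphXn mulrCA.
    rewrite -mulr_sumr => /eqP; rewrite mulf_eq0 fmorph_eq0 sqrtr_eq0 leNgt g0 //= => /eqP h.
    rewrite -[RHS]h (@horner_coef_wide _ r) ?size_poly //.
    by apply: eq_bigr => q _; rewrite coef_rVpoly_ord.
  have p0 : p = 0.
    apply/eqP/negPn/negP => p0.
    have := max_poly_roots (rs := [seq rc (t i) | i <- c]) p0.
    rewrite size_map map_inj_in_uniq ?uc; last first.
      by move=> i j ic jc /fmorph_inj; apply: tinj.
    move=> h; have : (size c < size p)%N.
      apply: h => //; apply/allP => _ /mapP[i ic ->]; apply/rootP; exact: pE.
    have : (size p <= r)%N by apply: size_poly.
    lia.
  by rewrite -[v]rVpolyK -/p p0 linear0.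
- by move=> q i /negbTE ic; rewrite mxE ic.
apply/matrixP => q q'; rewrite mul_mx_diag !mxE.
under eq_bigr => i _ do rewrite !mxE.
transitivity (\sum_(i <- c) u0 * rc s * (rc (t i ^+ (q + q') / w i) + 'i * rc (t i ^+ (q + q').+1 / w i))).
  rewrite (big_uniq _ uc) /= [RHS]big_mkcond; apply: eq_bigr => i _.
  case: ifP => ic; last by rewrite !mul0r.
  rewrite rcJ dE; set E := rc (eps R e i * rho i); set S := Num.sqrt (g i).
  have e1 : rc S * rc S * E = rc s / rc (w i).
    rewrite -!rmorphM -expr2 sqr_sqrtr ?ltW ?g0 // /g -fmorph_div; congr (rc _).
    have r0 : rho i != 0 by rewrite gt_eqF.
    transitivity (s * (eps R e i * eps R e i) / w i); first by field; rewrite r0 w0.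
    by rewrite eps_sqr mulr1.
  rewrite !fmorph_div !rmorphM !rmorphXn exprS exprD.
  transitivity (u0 * (rc S * rc S * E) * (rc (t i) ^+ q * rc (t i) ^+ q') * (1 + 'i * rc (t i))).
    by ring.
  by rewrite e1; ring.
rewrite -mulr_sumr big_split /= -mulr_sumr -!rmorph_sum.
have L m : (m < (size c).-1)%N -> \sum_(i <- c) t i ^+ m / w i = 0.
  move=> mc; rewrite -[RHS](lagrange_sum (P := 'X^m) uc tinj).
    by apply: eq_bigr => i _; rewrite hornerXn.
  by rewrite size_polyXn -ltn_predRL.
have rq := ltn_ord q; have rq' := ltn_ord q'.
rewrite !L ?rmorph0 ?mulr0 ?addr0 ?mulr0 //; lia.
Qed.
End ChainIsotropic.

Lemma count_sub_in (T : eqType) (a b : pred T) (s : seq T) :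
  {in s, forall x, a x -> b x} -> (count a s <= count b s)%N.
Proof.
move=> h; rewrite -(eq_in_count (a1 := predI a b)); last first.
  by move=> x xs /=; rewrite andb_idr // => /(h x xs).
by apply: sub_count => x /andP[].
Qed.

(** Here [e] marks the elements of the starting half-plane, and [c u] collects the steps at level u
    of the walk along increasing slopes. The bounds on the counts hold the heights between p and n -
    p, so every step has a level u with p <= u < n - p. *)
Lemma level_chains (R : rcfType) n (t : 'I_n -> R) (e : pred 'I_n) (p : nat) :
  let N := fun P : pred 'I_n => count P (enum 'I_n) in
  p = N e -> (p <= N (predC e))%N ->
  (forall i j, t i = t j -> e i = e j) ->
  (forall tau, (p <= N (fun i => e i == (tau <= t i)%R) <= n - p)%N) ->
  (forall tau, (p <= N (fun i => e i == (tau < t i)%R) <= n - p)%N) ->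
  exists c : nat -> seq 'I_n,
    [/\ forall u v i, i \in c u -> i \in c v -> u = v,
        forall u, sorted (fun y z => t y < t z) (c u),
        forall u, sorted (fun y z => e y != e z) (c u),
        forall u, (p <= u < n - p)%N -> odd (size (c u))
      & (\sum_(p <= u < n - p) size (c u) = n)%N].
Proof.
move=> N pE pN ties Hle Hlt.
pose s := sort (fun i j => t i <= t j) (enum 'I_n).
have ss : perm_eq s (enum 'I_n) by rewrite perm_sort.
have us : uniq s by rewrite (perm_uniq ss) enum_uniq.
have Ns P : N P = count P s by rewrite /N (seq.permP ss).
have sizes : size s = n by rewrite (perm_size ss) size_enum_ord.
have tot : total (fun i j : 'I_n => t i <= t j) by move=> i j; apply: le_total.
have tr : transitive (fun i j : 'I_n => t i <= t j) by move=> ? ? ?; apply: le_trans.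
have sorts : sorted (fun i j => t i <= t j) s by apply: sort_sorted.
have [lev levE] := levels_exists e us.
have count_e : (count e s + count (predC e) s = n)%N by rewrite count_predC sizes.
have Ue : (count e s = p)%N by rewrite -Ns.
exists (fun u => [seq i <- s | lev i == u]); split.
- by move=> u v i; rewrite !mem_filter => /andP[/eqP <- _] /andP[/eqP <- _].
- move=> u; have alt := level_alternates u levE.
  have : sorted (fun y z => t y <= t z) [seq i <- s | lev i == u] by apply: sorted_filter.
  have : sorted (fun y z => e y != e z) [seq i <- s | lev i == u].
    by move/path_sorted: alt; rewrite sorted_map.
  case: [seq i <- s | lev i == u] => // x c /= h1 h2.
  have : path (fun y z => (e y != e z) && (t y <= t z)) x c by rewrite path_relI h1.
  apply: sub_path => y z /andP[yz le_yz]; rewrite lt_neqAle le_yz andbT.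
  by apply: contra yz => /eqP /ties ->.
- move=> u; have alt := level_alternates u levE.
  by move/path_sorted: alt; rewrite sorted_map.
- move=> u /andP[pu un]; rewrite (level_parity _ levE) !add0n Ue.
  by rewrite ltnNge pu /=; lia.
(* Elements with the slope of x have the same value of [e], so the walk is monotone while passing
   them, and its heights around x lie between those before and after the tie. These are the counts
   in [Hle] and [Hlt]. The upper bound is strict because a level is the lower of two heights. *)
have range : all (fun l => (p <= l < n - p)%N) (levels e 0 s).
  apply/(all_nthP 0%N) => j; rewrite size_levels => js.
  have x0 : 'I_n by case: (s) js.
  set x := nth x0 s j; set s1 := take j s; set s2 := drop j.+1 s.
  have sE : s = s1 ++ x :: s2 by rewrite /s1 /s2 /x -drop_nth // cat_take_drop.
  have sz1 : size s1 = j by rewrite size_takel // ltnW.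
  rewrite sE -[in nth _ _ j]sz1 levels_cat add0n.
  have h1 i : i \in s1 -> t i <= t x.
    move=> i1; move: sorts; rewrite sE sorted_pairwise // pairwise_cat => /andP[/allrelP h _].
    by apply: h => //; rewrite inE eqxx.
  have h2 i : i \in s2 -> t x <= t i.
    move: sorts; rewrite sE sorted_pairwise // pairwise_cat /= => /and3P[_ _ /andP[/allP h _]].
    exact: h.
  have := Hle (t x); have := Hlt (t x); rewrite !Ns sE !count_cat /= lexx ltxx.
  set a1 := count _ s1; set a2 := count _ s2; set b1 := count _ s1; set b2 := count _ s2.
  set l1 := count _ s1; set l2 := count _ s2.
  have a1l : (a1 = l1)%N.
    by apply: eq_in_count => i /h1 hi /=; rewrite ltNge hi; case: (e i).
  have b2l : (b2 = l2)%N.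
    by apply: eq_in_count => i /h2 hi /=; rewrite hi; case: (e i).
  case ex: (e x) => /=.
    have b1l : (l1 <= b1)%N.
      apply: count_sub_in => i /h1 hi /=; case: leP => [h|_]; last by case: (e i).
      by rewrite (ties i x) ?ex //; apply/eqP; rewrite eq_le hi h.
    have a2l : (a2 <= l2)%N.
      apply: count_sub_in => i /h2 hi /=; case: ltP => [_|h]; first by case: (e i).
      by rewrite (ties i x) ?ex //; apply/eqP; rewrite eq_le hi h.
    lia.
  have b1l : (b1 <= l1)%N.
    apply: count_sub_in => i /h1 hi /=; case: leP => [h|_]; last by case: (e i).
    by rewrite (ties i x) ?ex //; apply/eqP; rewrite eq_le hi h.
  have a2l : (l2 <= a2)%N.
    apply: count_sub_in => i /h2 hi /=; case: ltP => [_|h]; first by case: (e i).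
    by rewrite (ties i x) ?ex //; apply/eqP; rewrite eq_le hi h.
  lia.
rewrite -[RHS]sizes -(size_levels e 0 s) -(sum_levels range) -levE.
by apply: eq_bigr => u _; rewrite size_filter count_map.
Qed.

(** * Sums of isotropic spaces and a count of diagonal entries *)

Section Merge.
Variable C : numClosedFieldType.

Lemma supported_sub m n (V : 'M[C]_(m, n)) (v : 'rV[C]_n) i :
  (v <= V)%MS -> (forall q, V q i = 0) -> v 0 i = 0.
Proof. by move=> /submxP[D ->] Vi; rewrite mxE big1 // => q _; rewrite Vi mulr0. Qed.

(** As the supports are disjoint, the ranks add up and a diagonal form has no cross terms. *)
Lemma merge_isotropic n (d : 'rV[C]_n) (c : nat -> seq 'I_n) (r : nat -> nat) us :
  (forall u v i, i \in c u -> i \in c v -> u = v) ->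
  (forall u, u \in us -> exists V : 'M[C]_(r u, n), [/\ row_free V,
     forall q i, i \notin c u -> V q i = 0 & V *m diag_mx d *m V^t* = 0]) ->
  uniq us ->
  exists m (V : 'M[C]_(m, n)), [/\ (\sum_(u <- us) r u <= \rank V)%N,
     forall q i, (forall u, u \in us -> i \notin c u) -> V q i = 0
   & V *m diag_mx d *m V^t* = 0].
Proof.
move=> disj; elim: us => [|u us IH] hV.
  exists 0%N, 0; rewrite big_nil; split => //; first by case.
  by apply/matrixP; case.
move=> /= /andP[uus ius].
have [|m [V [rV sV iV]]] := IH _ ius; first by move=> v vus; apply: hV; rewrite inE vus orbT.
have [|W [/eqP rW sW iW]] := hV u; first by rewrite inE eqxx.
have split_i i : i \in c u -> forall v, v \in us -> i \notin c v.
  move=> iu v vus; apply: contra uus => iv.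
  by rewrite (disj u v i).
exists (r u + m)%N, (col_mx W V); split.
- rewrite big_cons -addsmxE mxrank_disjoint_sum ?rW ?leq_add2l //.
  apply/eqP/negPn/negP => /rowV0Pn[v]; rewrite sub_capmx => /andP[vW vV] /negP; apply.
  apply/eqP/rowP => i; rewrite [RHS]mxE; have [iu|iu] := boolP (i \in c u).
    by apply: supported_sub vV _ => q; apply: sV; apply: split_i.
  by apply: supported_sub vW _ => q; apply: sW.
- move=> q i hi; rewrite mxE; case: splitP => q' _.
    by apply: sW; apply: hi; rewrite inE eqxx.
  by apply: sV => v vus; apply: hi; rewrite inE vus orbT.
have cross : W *m diag_mx d *m V^t* = 0.
  apply/matrixP => q q'; rewrite mul_mx_diag !mxE big1 // => i _; rewrite !mxE.
  have [iu|iu] := boolP (i \in c u).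
    by rewrite (sV q' i) ?conjC0 ?mulr0 //; apply: split_i.
  by rewrite (sW q i) // !mul0r.
have cross' : V *m diag_mx d *m W^t* = 0.
  apply/matrixP => q q'; rewrite mul_mx_diag !mxE big1 // => i _; rewrite !mxE.
  have [iu|iu] := boolP (i \in c u).
    by rewrite (sV q i) ?mul0r //; apply: split_i.
  by rewrite (sW q' i) // conjC0 mulr0.
by rewrite tr_col_mx map_row_mx mul_col_mx mul_col_row iV iW cross cross' /block_mx !row_mx0 col_mx0.
Qed.

(** With fewer than k such entries, V would meet the coordinate space of the remaining ones, where
    the real part of the form times u is negative definite. *)
Lemma diag_count k n (d : 'rV[C]_n) (u : C) (V : 'M[C]_n) :
  (k <= \rank V)%N -> (forall v : 'rV[C]_n, (v <= V)%MS -> 0 <= 'Re (u * sesq (diag_mx d) v v)) ->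
  (k <= count (fun i => (0 <= 'Re (u * d 0 i))%R) (enum 'I_n))%N.
Proof.
move=> rV nnV; pose S := [set i | (0 <= 'Re (u * d 0 i))%R].
rewrite (_ : count _ _ = #|S|); last by rewrite /S cardsE cardE enumT size_filter.
rewrite leqNgt; apply/negP => kS.
pose M : 'M[C]_(n, #|S|) := \matrix_(i, j) (i == enum_val j)%:R.
have := mxrank_mul_ker V M; have : (\rank (V *m M) <= #|S|)%N by apply: rank_leq_col.
move=> h1 h2; have : (V :&: kermx M)%MS != 0 by
  rewrite -mxrank_eq0 -lt0n -(ltn_add2l (\rank (V *m M))) addn0 h2 (leq_ltn_trans h1) // (leq_trans kS).
case/rowV0Pn => v; rewrite sub_capmx sub_kermx_rV => /andP[vV /eqP vM] v0.
have vS i : i \in S -> v 0 i = 0.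
  move=> iS; have /matrixP/(_ 0 (enum_rank_in iS i)) := vM; rewrite !mxE.
  rewrite (bigD1 i) //= mxE enum_rankK_in // eqxx mulr1 big1 ?addr0 // => j ji.
  by rewrite mxE enum_rankK_in // (negbTE ji) mulr0.
have [i vi] : exists i, v 0 i != 0.
  apply/existsP; apply: contraNT v0; rewrite negb_exists => /forallP h.
  by apply/eqP/rowP => i; rewrite [RHS]mxE; apply/eqP; move: (h i); rewrite negbK.
have := nnV v vV; rewrite /sesq mul_mx_diag mxE mulr_sumr raddf_sum /=.
have term j : 'Re (u * ((\matrix_(a, b) (v a b * d 0 b)) 0 j * v^t* j 0)) =
    'Re (u * d 0 j) * `|v 0 j| ^+ 2.
  rewrite !mxE normCK; rewrite (_ : u * _ = (v 0 j * (v 0 j)^*) * (u * d 0 j)); last by ring.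
  have rv : v 0 j * (v 0 j)^* \is Num.real by apply/ger0_real/mul_conjC_ge0.
  by rewrite (ReMl rv) [LHS]mulrC.
under eq_bigr do rewrite term.
have neg j : v 0 j != 0 -> 'Re (u * d 0 j) < 0.
  move=> vj; rewrite real_ltNge ?Creal_Re // ?real0 //; apply: contra vj => hj.
  by rewrite vS // inE.
have npos j : 'Re (u * d 0 j) * `|v 0 j| ^+ 2 <= 0.
  have [->|/neg h] := eqVneq (v 0 j) 0; first by rewrite normr0 expr0n mulr0.
  by apply: mulr_le0_ge0; rewrite ?(ltW h) ?exprn_ge0.
move=> pos; suff : \sum_j 'Re (u * d 0 j) * `|v 0 j| ^+ 2 < 0 by move/(le_lt_trans pos); rewrite ltxx.
rewrite (bigD1 i) //= -[ltRHS]addr0 ltr_leD ?sumr_le0 // nmulr_rlt0 ?neg //.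
by rewrite exprn_gt0 // normr_gt0.
Qed.
End Merge.

Section Scalars.
Variable R : rcfType.
Implicit Types z w : (R[i] : numClosedFieldType).

Lemma cReD z w : complex.Re (z + w) = complex.Re z + complex.Re w.
Proof. by case: z => a b; case: w => c d. Qed.

Lemma cReN z : complex.Re (- z) = - complex.Re z.
Proof. by case: z. Qed.

Lemma cReM z w : complex.Re (z * w) =
  complex.Re z * complex.Re w - complex.Im z * complex.Im w.
Proof. by case: z => a b; case: w => c d. Qed.

Lemma cReJ z : complex.Re (Num.conj z) = complex.Re z.
Proof. by case: z. Qed.

Lemma eqC z w : complex.Re z = complex.Re w -> complex.Im z = complex.Im w ->
  z = w.
Proof. by case: z => a b; case: w => c d /= -> ->. Qed.

Lemma real_ImE z : (z \is Num.real) = (complex.Im z == 0).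
Proof. by case: z => a b; rewrite complex_real. Qed.

Lemma ReC_E z : 'Re z = (complex.Re z)%:C%C.
Proof. by rewrite ReE [RHS]ReJ_add. Qed.

Lemma Re_ge0E z : (0 <= 'Re z) = (0 <= complex.Re z).
Proof. by rewrite ReC_E ler0c. Qed.

Lemma eqC0 z : (z == 0) = (complex.Re z == 0) && (complex.Im z == 0).
Proof. by rewrite eq_complex. Qed.

(** Multiplication by - i - tau carries the line of slope tau to the imaginary axis, so this real
    part tells on which side of the line z lies. *)
Lemma Re_cut (tau : R) z :
  complex.Re ((-'i%C - tau%:C%C) * z) = complex.Im z - tau * complex.Re z.
Proof. by case: z => a b /=; ring. Qed.

Lemma Im_cut (tau : R) z :
  complex.Im ((-'i%C - tau%:C%C) * z) = - complex.Re z - tau * complex.Im z.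
Proof. by case: z => a b /=; ring. Qed.

Lemma slope_form z : complex.Re z != 0 ->
  z = (complex.Re z)%:C%C * (1 + 'i%C * (complex.Im z / complex.Re z)%:C%C).
Proof.
case: z => a b /= a0; apply: eqC => /=; first by ring.
by field.
Qed.

End Scalars.

(** * Diagonal forms without zero or antipodal entries *)

Section Diagonal.
Variable R : rcfType.
Local Notation C := (R[i] : numClosedFieldType).

Lemma diag_isotropic n k (d : 'rV[C]_n) :
  (forall i, d 0 i != 0) ->
  (forall i j (a : R), 0 < a -> d 0 i != - (a%:C%C * d 0 j)) ->
  halfplane_cond k (diag_mx d) -> isotropic k (diag_mx d).
Proof.
move=> d0 nanti [F F0 hF].
pose re (u : R[i]) i := complex.Re (u * d 0 i).
pose im (u : R[i]) i := complex.Im (u * d 0 i).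
pose N (u : R[i]) := count (fun i => 0 < re u i) (enum 'I_n).
(* The hypothesis applies to a good direction, and no entry lies on the boundary of its half-plane;
   so the counts [N] of opposite good directions add up to n. *)
pose good (u : R[i]) := [/\ u != 0, all (fun f => u * f^* \isn't Num.real) F & forall i, re u i != 0].
have goodN u : good u -> good (- u).
  case=> u0 uF ui; split; first by rewrite oppr_eq0.
    by apply: sub_all uF => f; rewrite mulNr rpredN.
  by move=> i; rewrite /re mulNr cReN oppr_eq0; apply: ui.
have NN u : good u -> (N u + N (- u) = n)%N.
  case=> _ _ ui; rewrite -[RHS]size_enum_ord -(count_predC (fun i => 0 < re u i)).
  congr (_ + _)%N; apply: eq_count => i /=.
  by rewrite /re mulNr cReN oppr_gt0 -leNgt lt_neqAle ui.
have Nk u : good u -> (k <= N u)%N.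
  case=> u0 uF ui; have [V [rV nnV]] := hF u u0 uF.
  apply: leq_trans (diag_count rV nnV) _; apply: sub_count => i.
  by rewrite Re_ge0E lt_neqAle eq_sym ui.
(* Each entry and each element of F excludes at most one value of tau. *)
have cut w : w != 0 -> exists L : seq R, forall tau, tau \notin L -> good ((-'i%C - tau%:C%C) * w).
  move=> w0; exists ([seq - (complex.Re (w * f^* ) / complex.Im (w * f^* )) | f <- F] ++
                 [seq im w i / re w i | i <- enum 'I_n]) => tau.
  rewrite mem_cat negb_or => /andP[tauF taud]; split.
  - by rewrite mulf_neq0 // eqC0 negb_and; apply/orP; right; rewrite /= subr0 oppr_eq0 oner_eq0.
  - apply/allP => f fF; rewrite -mulrA real_ImE Im_cut.
    have : w * f^* != 0.
      by rewrite mulf_neq0 // conjC_eq0; apply: contraNneq F0 => <-.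
    set z := w * f^*; apply: contra => /eqP e.
    have [z0|z0] := eqVneq (complex.Im z) 0.
      by move: e; rewrite eqC0 z0 mulr0 subr0 => /eqP; rewrite oppr_eq0 => ->; rewrite eqxx.
    case/negP: tauF; apply/mapP; exists f => //; rewrite -/z.
    by apply: (mulIf z0); rewrite mulNr divfK //; lra.
  move=> i; rewrite /re -mulrA Re_cut.
  have : w * d 0 i != 0 by rewrite mulf_neq0.
  set z := w * d 0 i; apply: contra => /eqP e.
  have [z0|z0] := eqVneq (complex.Re z) 0.
    by move: e; rewrite eqC0 z0 mulr0 subr0 => ->; rewrite eqxx.
  case/negP: taud; apply/mapP; exists i; rewrite ?mem_enum // /im /re -/z.
  by apply: (mulIf z0); rewrite divfK //; lra.
(* Minimality, applied to a direction and to its opposite, holds all the counts between p and n -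
   p. *)
have [u0 gu0 minu0] : exists2 u0, good u0 & forall u, good u -> (N u0 <= N u)%N.
  have ex : exists m, `[< exists2 u, good u & N u = m >].
    have [L hL] := cut 1 (oner_neq0 _).
    have [tau tau0 tauL] := avoid_below L 0.
    exists (N ((-'i%C - tau%:C%C) * 1)); apply/asboolP; eexists; last by [].
    by apply: hL; apply/negP => /tauL; rewrite lexx tau0.
  case: (ex_minnP ex) => m /asboolP[u0 gu0 <-] min0; exists u0 => // u gu.
  by apply: min0; apply/asboolP; exists u.
set p := N u0.
pose t i := im u0 i / re u0 i; pose e i := 0 < re u0 i.
have re0 i : re u0 i != 0 by case: gu0.
have uz : u0 != 0 by case: gu0.
have [L hL] := cut u0 uz.
have dE i : d 0 i = u0^-1 * ((re u0 i)%:C%C * (1 + 'i%C * (t i)%:C%C)).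
  by apply: (mulfI uz); rewrite mulVKf // {1}(slope_form (re0 i)).
(* Entries of equal slope on different sides of the boundary line would be antipodal. *)
have ties i j : t i = t j -> e i = e j.
  move=> tij; apply/eqP/negPn/negP => eij.
  have a0 : 0 < - (re u0 i / re u0 j).
    rewrite oppr_gt0; move: eij; rewrite /e; case: ltgtP (re0 i) => // hi _;
    case: ltgtP (re0 j) => // hj _ _; move: hi hj.
      by move=> hi hj; rewrite nmulr_llt0 ?invr_lt0.
    by move=> hi hj; rewrite pmulr_llt0 ?invr_gt0.
  have /negP := nanti i j _ a0; apply; apply/eqP.
  rewrite (dE i) (dE j) -tij rmorphN mulNr opprK [RHS]mulrCA; congr (_ * _).
  by rewrite mulrA -rmorphM divfK.
have cutN tau : tau \notin L ->
    (p <= count (fun i => e i == (tau < t i)%R) (enum 'I_n) <= n - p)%N.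
  move=> /hL gu; have h1 := minu0 _ gu; have h2 := minu0 _ (goodN _ gu).
  have h3 := NN _ gu.
  have -> : count (fun i => e i == (tau < t i)%R) (enum 'I_n) = N ((-'i%C - tau%:C%C) * u0).
    apply: eq_count => i.
    have : re ((-'i%C - tau%:C%C) * u0) i != 0 by case: gu.
    rewrite /re -mulrA Re_cut -/(im u0 i) -/(re u0 i).
    have -> : im u0 i - tau * re u0 i = re u0 i * (t i - tau).
      by rewrite mulrBr /t [re u0 i * (_ / _)]mulrC divfK // [tau * _]mulrC.
    rewrite mulf_eq0 negb_or subr_eq0 => /andP[_ ne].
    rewrite /e; case: ltgtP (re0 i) => // h _.
      by rewrite pmulr_rgt0 // subr_gt0; case: ltP.
    by rewrite nmulr_rgt0 // subr_lt0; move: ne; case: ltgtP.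
  lia.
(* Replacing tau by a slightly smaller s that skips no slope and no excluded value turns tau <= t i
   into s < t i; for [Hlt] tau moves up instead. *)
have Hle tau : (p <= count (fun i => e i == (tau <= t i)%R) (enum 'I_n) <= n - p)%N.
  have [s st sL] := avoid_below (L ++ map t (enum 'I_n)) tau.
  have sL' : s \notin L.
    by apply/negP => h; have := sL s; rewrite mem_cat h lexx st => /(_ isT).
  have := cutN s sL'; rewrite (@eq_count _ _ (fun i => e i == (tau <= t i)%R)) // => i; congr (_ == _).
  have := sL (t i); rewrite mem_cat (map_f t) ?mem_enum // orbT => /(_ isT).
  case: (leP tau (t i)) => [h _|h]; first by rewrite (lt_le_trans st).
  by rewrite andbT -ltNge => h'; apply/negbTE; rewrite -leNgt ltW.
have Hlt tau : (p <= count (fun i => e i == (tau < t i)%R) (enum 'I_n) <= n - p)%N.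
  have [s st sL] := avoid_above (L ++ map t (enum 'I_n)) tau.
  have sL' : s \notin L.
    by apply/negP => h; have := sL s; rewrite mem_cat h lexx st => /(_ isT).
  have := cutN s sL'; rewrite (@eq_count _ _ (fun i => e i == (tau < t i)%R)) // => i; congr (_ == _).
  have := sL (t i); rewrite mem_cat (map_f t) ?mem_enum // orbT => /(_ isT).
  case: (ltP tau (t i)) => [h /=|h _]; first by rewrite -ltNge.
  by apply/negbTE; rewrite -leNgt (le_trans h) // ltW.
have pC : (p <= count (predC e) (enum 'I_n))%N.
  have := minu0 _ (goodN _ gu0); have := NN _ gu0; rewrite /N -/p.
  have := count_predC e (enum 'I_n); rewrite size_enum_ord -/(N u0) -/p; lia.
have [c [disj ct ce codd csum]] := level_chains (erefl p) pC ties Hle Hlt.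
pose us := index_iota p (n - p).
have [||m [V [rV _ iV]]] := merge_isotropic (d := d) (r := fun u => (size (c u))./2) (us := us) disj.
- move=> u; rewrite mem_index_iota => /codd ou.
  apply: (@chain_isotropic _ _ (real_complex R) _ _ d u0^-1 (fun i => `|re u0 i|) t e) => //.
  + by move=> x; apply: eqC => /=; rewrite ?oppr0.
  + by move=> i; rewrite normr_gt0.
  + move=> i; rewrite dE; congr (_ * (_ * _)); congr (real_complex R _).
    rewrite /eps /e; case: ltP => h; first by rewrite mul1r gtr0_norm.
    by rewrite ler0_norm // mulN1r opprK.
  by rewrite -[X in (_ < X)%N](odd_double_half (size (c u))) ou.
- by rewrite iota_uniq.
apply: isotropic_gen iV; apply: leq_trans rV.
(* There are n - 2 p chains, of odd sizes 2 r_u + 1 with sum n, so the r_u add up to p. *)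
suff -> : (\sum_(u <- us) (size (c u))./2 = p)%N by apply: Nk.
have : (\sum_(p <= u < n - p) (1 + (size (c u))./2.*2) = n)%N.
  rewrite -[RHS]csum; apply: eq_big_nat => u hu.
  by rewrite -[RHS]odd_double_half codd.
rewrite big_split /= sum_nat_const_nat muln1.
have -> : (\sum_(p <= i < n - p) (size (c i))./2.*2 = (\sum_(u <- us) (size (c u))./2).*2)%N.
  by rewrite (big_morph double doubleD double0).
have := NN _ gu0; have := minu0 _ (goodN _ gu0); rewrite -/p; lia.
Qed.
End Diagonal.

(** * From half-plane conditions to isotropic subspaces *)

Section Isotropic.
Variable R : rcfType.
Local Notation C := (R[i] : numClosedFieldType).

Lemma reducing_congr (K : numClosedFieldType) n (A Q : 'M[K]_n) (x : 'rV[K]_n) :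
  row_free Q -> reducing (Q *m A *m Q^t*) x -> reducing A (x *m Q).
Proof.
move=> fQ [x0 xx [a [b [ab e]]]]; split.
- by rewrite mulmx_free_eq0.
- by rewrite sesq_mul.
exists a, b; split=> //.
have Qt : Q^t* \in unitmx by rewrite map_unitmx unitmx_tr -row_free_unit.
apply: (can_inj (mulmxK Qt)); rewrite mul0mx -[RHS]e mulmxDl -!scalemxAl.
by rewrite !trmxC_mul trmxCK !mulmxA.
Qed.

(** A zero entry makes a basis vector reducing. If d_i = - a d_j with a > 0, the vector e_i + sqrt a
    e_j is isotropic, and its images under the diagonal matrix and its adjoint are multiples of one
    vector. *)
Lemma diag_no_reducing n (d : 'rV[C]_n) : (forall x, ~ reducing (diag_mx d) x) ->
  (forall i, d 0 i != 0) /\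
  (forall i j (a : R), 0 < a -> d 0 i != - (a%:C%C * d 0 j)).
Proof.
move=> no; pose E i : 'rV[C]_n := 'e_i.
have deltaD i (d' : 'rV[C]_n) : (E i) *m diag_mx d' = d' 0 i *: (E i).
  apply/rowP => j; rewrite mul_mx_diag !mxE eqxx /=.
  by case: eqP => [->|_]; rewrite ?mulr1 ?mul1r ?mulr0 ?mul0r.
have Dt : (diag_mx d)^t* = diag_mx (map_mx Num.conj d).
  by rewrite tr_diag_mx map_diag_mx.
have delta0 i : E i != 0.
  by apply/eqP => /matrixP/(_ 0 i); rewrite !mxE !eqxx /= => /eqP; rewrite oner_eq0.
have d0 i : d 0 i != 0.
  apply/negP => /eqP di; apply: (no (E i)); split => //.
    by rewrite /sesq deltaD di scale0r mul0mx mxE.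
  by exists 1, 0; rewrite oner_neq0 deltaD di !scale0r scaler0 addr0.
split=> // i j a a0; apply/negP => /eqP dij.
have ij : i != j.
  apply/negP => /eqP ij; move: dij; rewrite -ij => /eqP.
  rewrite -subr_eq0 opprK -{1}[d 0 i]mul1r -mulrDl mulf_eq0 (negbTE (d0 i)) orbF.
  by rewrite eqC0 /= gt_eqF //; lra.
pose s : C := (Num.sqrt a)%:C%C.
have ss : s * s = a%:C%C by rewrite -rmorphM -expr2 sqr_sqrtr // ltW.
have sJ : s^* = s by exact: conjc_real.
pose x : 'rV[C]_n := (E i) + s *: (E j).
have xD (d' : 'rV[C]_n) : x *m diag_mx d' = d' 0 i *: (E i) + (s * d' 0 j) *: (E j).
  by rewrite mulmxDl -scalemxAl !deltaD scalerA.
apply: (no x); split.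
- apply/eqP => /matrixP/(_ 0 i); rewrite !mxE !eqxx (negbTE ij) /= mulr0 addr0 => /eqP.
  by rewrite oner_eq0.
- have dd p q : ((E p) *m (E q)^t*) 0 0 = (p == q)%:R :> C.
    rewrite mxE (bigD1 p) //= !mxE !eqxx mul1r /= conjC_nat big1 ?addr0 // => l /negbTE lp.
    by rewrite !mxE lp mul0r.
  have sE p q : sesq (diag_mx d) (E p) (E q) = d 0 p * (p == q)%:R.
    by rewrite /sesq deltaD -scalemxAl mxE dd.
  rewrite /x sesqDl !sesqDr !sesqZl !sesqZr !sE sJ !eqxx (eq_sym j i) (negbTE ij).
  rewrite !mulr0 addr0 add0r !mulr1 mulrA ss dij; exact: addNr.
exists (d 0 j)^*, (- d 0 j); rewrite conjC_eq0 d0; split=> //.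
have aJ : (a%:C%C)^* = a%:C%C :> C by exact: conjc_real.
rewrite Dt !xD !mxE dij rmorphN rmorphM /= aJ !scalerDr !scalerA addrACA -!scalerDl.
set D := d 0 j; set D' := D^*; set a' := a%:C%C; set s' := s.
have -> : D' * - (a' * D) + - D * - (a' * D') = 0 by ring.
have -> : D' * (s' * D) + - D * (s' * D') = 0 by ring.
by rewrite !scale0r addr0.
Qed.

(** Strong induction on the size of A: a reducing vector leads to a smaller matrix, and without one
    A is congruent to a diagonal matrix, where the chains apply. *)
Theorem isotropic_of_halfplane n k (A : 'M[C]_n) : halfplane_cond k A -> isotropic k A.
Proof.
have [m] := ubnP n; elim: m n k A => // m IH n [|k] A nm.
  by exists 0; rewrite !mul0mx.
have [[x redx]|no] := pselect (exists x, reducing A x).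
  move=> hA; apply: (isotropic_reduce redx hA) => m' B m'n; apply: IH.
  exact: leq_trans m'n _.
have noA x : ~ reducing A x by move=> h; apply: no; exists x.
have [Q [d [fQ dE]]] := congruent_diag noA.
have noD x : ~ reducing (diag_mx d) x.
  by rewrite -dE => /(reducing_congr fQ); apply: noA.
have [d0 nanti] := diag_no_reducing noD.
case=> F F0 hF.
have Qu : Q \in unitmx by rewrite -row_free_unit.
have [|Z [rZ iZ]] := diag_isotropic (k := k.+1) d0 nanti.
  exists F; first exact: F0.
  move=> u u0 uF; have [V [rV nnV]] := hF u u0 uF.
  exists (V *m invmx Q); rewrite mxrankMfree ?row_free_unit ?unitmx_inv //; split=> // v vV.
  by rewrite -dE -sesq_mul; apply: nnV; rewrite -(mulmxKV Qu V) submxMr.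
apply: (isotropic_gen (V := Z *m Q)); first by rewrite mxrankMfree.
by rewrite trmxC_mul -iZ -dE !mulmxA.
Qed.

End Isotropic.

(** * Sorted eigenvalues and the Courant-Fischer inequalities *)

Lemma char_poly_similar (F : fieldType) n (P A B : 'M[F]_n) :
  P \in unitmx -> A = invmx P *m B *m P -> char_poly A = char_poly B.
Proof.
move=> uP AE; rewrite /char_poly.
have -> : char_poly_mx A = map_mx polyC (invmx P) *m char_poly_mx B *m map_mx polyC P.
  rewrite /char_poly_mx mulmxBr mulmxBl -!map_mxM -AE; congr (_ - _).
  by rewrite mul_mx_scalar -scalemxAl -map_mxM mulVmx // map_mx1 scalemx1.
rewrite !det_mulmx mulrAC -det_mulmx -map_mxM mulVmx // map_mx1 det1 mul1r //.
Qed.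

Section Spectral.
Variable R : realType.
Local Notation C := (R[i] : numClosedFieldType).

(** The index starts at 0, whereas that of [lambda] starts at 1. *)
Definition eigen n (M : 'M[C]_n) (j : nat) : R := nth 0 (herm_eigenvalues M) j.

(** The spectral theorem gives the diagonal in some order. Comparing characteristic polynomials
    shows that it is a permutation of the sorted eigenvalues, and this permutation is applied to the
    rows of the unitary matrix, which are eigenvectors. *)
Lemma hermitian_sorted_diag n (M : 'M[C]_n) : M^t* = M ->
  exists2 S : 'M[C]_n, S \is unitarymx &
    S *m M *m S^t* = diag_mx (\row_j (eigen M j)%:C%C).
Proof.
move=> hM.
have nM : M \is normalmx by apply/normalmxP; rewrite hM.
have symM : M \is hermsymmx by apply/is_hermitianmxP; rewrite expr0 scale1r hM.
have /orthomx_spectralP := nM; have := spectral_unitarymx M.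
have /mxOverP := hermitian_spectral_diag_real symM.
set P := spectralmx M; set D := spectral_diag M => Dreal uP ME.
pose Ds := [tuple D 0 j | j < n].
have charM : char_poly M = \prod_(z <- Ds) ('X - z%:P).
  rewrite (char_poly_similar (unitarymx_unit uP) ME) char_poly_trig ?diag_mx_is_trig //.
  rewrite big_tuple; apply: eq_bigr => j _.
  by rewrite tnth_mktuple mxE eqxx mulr1n.
have perm : perm_eq (herm_eigenvalues M) [seq complex.Re x | x <- Ds].
  rewrite /herm_eigenvalues perm_sort; apply: perm_map.
  case: (closed_field_poly_normal _) => s /= sE; apply: prod_XsubC_eq.
  by rewrite -charM sE (monicP (char_poly_monic M)) scale1r.
have [p pE] := tuple_permP (t := [tuple of [seq complex.Re x | x <- Ds]]) perm.
have ent (Q : 'M[C]_n) a b : (row_perm p P *m Q *m (row_perm p P)^t*) a b = (P *m Q *m P^t*) (p a) (p b).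
  rewrite !mxE; apply: eq_bigr => j _; rewrite !mxE; congr (_ * _).
  by apply: eq_bigr => i _; rewrite !mxE.
exists (row_perm p P).
  apply/unitarymxP; rewrite -[X in X *m _]mulmx1; apply/matrixP => a b.
  by rewrite ent mulmx1 (unitarymxP uP) !mxE (inj_eq perm_inj).
apply/matrixP => a b; rewrite ent.
have -> : P *m M *m P^t* = diag_mx D.
  have -> : P *m M *m P^t* = P *m (invmx P *m diag_mx D *m P) *m invmx P.
    by rewrite -ME invmx_unitary.
  by rewrite !mulmxA mulmxV ?unitarymx_unit // mul1mx mulmxK ?unitarymx_unit.
rewrite !mxE (inj_eq perm_inj); congr (_ *+ _); rewrite /eigen pE.
rewrite (nth_map a) ?size_enum_ord // nth_ord_enum (tnth_nth 0) /=.
by rewrite -map_comp (nth_map a) ?size_enum_ord // nth_ord_enum /= RRe_real.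
Qed.

Lemma size_herm_eigenvalues n (M : 'M[C]_n) : size (herm_eigenvalues M) = n.
Proof.
rewrite /herm_eigenvalues size_sort size_map.
case: (closed_field_poly_normal _) => s /= sE.
have := size_char_poly M; rewrite sE (monicP (char_poly_monic M)) scale1r size_prod_XsubC.
by case.
Qed.

Lemma eigen_antitone n (M : 'M[C]_n) i j : (i <= j < n)%N -> eigen M j <= eigen M i.
Proof.
move=> /andP[ij jn]; have := @sort_sorted _ (>=%R) ge_total
  [seq complex.Re x | x <- sval (closed_field_poly_normal (char_poly M))].
rewrite -/(herm_eigenvalues M) => /(sorted_leq_nth ge_trans lexx 0).
by apply => //; rewrite inE size_herm_eigenvalues // (leq_ltn_trans ij).
Qed.
End Spectral.

(** * Quadratic forms and min-max bounds *)

Section QuadraticForms.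
Variable R : realType.
Local Notation C := (R[i] : numClosedFieldType).

Definition qf n (M : 'M[C]_n) (v : 'rV[C]_n) : R := complex.Re (sesq M v v).

(** This is the square of the Euclidean norm. *)
Definition nrm n (v : 'rV[C]_n) : R := qf 1%:M v.

Definition sqmod (z : C) : R := complex.Re z ^+ 2 + complex.Im z ^+ 2.

Lemma sqmod_ge0 z : 0 <= sqmod z.
Proof. by rewrite addr_ge0 ?sqr_ge0. Qed.

Lemma sqmod0 : sqmod 0 = 0.
Proof. by rewrite /sqmod /= expr0n addr0. Qed.

Lemma sqmod_eq0 z : (sqmod z == 0) = (z == 0).
Proof. by rewrite /sqmod paddr_eq0 ?sqr_ge0 // !sqrf_eq0 eqC0. Qed.

Lemma qf_diag n (l : 'I_n -> R) (c : 'rV[C]_n) :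
  qf (diag_mx (\row_j (l j)%:C%C)) c = \sum_j l j * sqmod (c 0 j).
Proof.
rewrite /qf /sesq mul_mx_diag mxE (big_morph _ (@cReD R) (erefl _)).
apply: eq_bigr => j _; rewrite !mxE /sqmod.
by case: (c 0 j) => a b /=; ring.
Qed.

Lemma nrmE n (c : 'rV[C]_n) : nrm c = \sum_j sqmod (c 0 j).
Proof.
have -> : nrm c = qf (diag_mx (\row_j (1 : R)%:C%C)) c.
  rewrite /nrm -diag_const_mx; congr (qf (diag_mx _) _).
  by apply/rowP => j; rewrite !mxE.
by rewrite qf_diag; apply: eq_bigr => j _; rewrite mul1r.
Qed.

Lemma nrm_ge0 n (c : 'rV[C]_n) : 0 <= nrm c.
Proof. by rewrite nrmE sumr_ge0 // => j _; apply: sqmod_ge0. Qed.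

Lemma nrm_gt0 n (c : 'rV[C]_n) : c != 0 -> 0 < nrm c.
Proof.
move=> c0; rewrite lt_neqAle nrm_ge0 andbT eq_sym nrmE.
apply: contra c0; rewrite psumr_eq0; last by move=> j _; apply: sqmod_ge0.
move=> /allP h; apply/eqP/rowP => j; rewrite [RHS]mxE; apply/eqP.
by rewrite -sqmod_eq0; apply: h; rewrite mem_index_enum.
Qed.

Lemma nrm_unitary n (S : 'M[C]_n) c : S \is unitarymx -> nrm (c *m S) = nrm c.
Proof. by move=> /unitarymxP uS; rewrite /nrm /qf sesq_mul mulmx1 uS. Qed.

Lemma rowsub_span m n (f : 'I_m -> 'I_n) (S : 'M[C]_n) :
  injective f -> S \is unitarymx ->
  \rank (rowsub f S) = m /\
  forall v : 'rV[C]_n, (v <= rowsub f S)%MS ->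
    exists2 c : 'rV[C]_n, v = c *m S & forall j, (forall i, f i != j) -> c 0 j = 0.
Proof.
move=> finj uS; split.
  apply: mxrank_unitary; apply/unitarymxP; apply/matrixP => a b.
  have /unitarymxP/matrixP/(_ (f a) (f b)) := uS; rewrite !mxE (inj_eq finj) => <-.
  by apply: eq_bigr => j _; rewrite !mxE.
move=> v /submxP[D ->]; exists (D *m rowsub f 1%:M).
  by rewrite -mulmxA mul_rowsub_mx mul1mx.
move=> j fj; rewrite mxE big1 // => q _.
by rewrite !mxE (negbTE (fj q)) mulr0.
Qed.

Lemma meet_subspaces m p n (V : 'M[C]_(m, n)) (W : 'M[C]_(p, n)) :
  (n < \rank V + \rank W)%N -> exists2 v : 'rV[C]_n, v != 0 & (v <= V)%MS && (v <= W)%MS.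
Proof.
move=> h; have : (V :&: W)%MS != 0.
  rewrite -mxrank_eq0 -lt0n -(ltn_add2l (\rank (V + W)%MS)) addn0 mxrank_sum_cap.
  exact: leq_ltn_trans (rank_leq_col _) h.
by case/rowV0Pn => v; rewrite sub_capmx => vVW v0; exists v.
Qed.

Section CourantFischer.
Variables (n : nat) (M : 'M[C]_n) (S : 'M[C]_n).
Hypothesis uS : S \is unitarymx.
Hypothesis SE : S *m M *m S^t* = diag_mx (\row_j (eigen M j)%:C%C).

Lemma qf_coords c : qf M (c *m S) = \sum_(j < n) eigen M j * sqmod (c 0 j).
Proof. by rewrite /qf sesq_mul SE -qf_diag. Qed.

Lemma top_space k : (k < n)%N -> exists V : 'M[C]_(k.+1, n),
  \rank V = k.+1 /\ forall v : 'rV[C]_n, (v <= V)%MS -> eigen M k * nrm v <= qf M v.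
Proof.
move=> kn; pose f := widen_ord kn; have finj : injective f by move=> i j /(congr1 val) /= /val_inj.
have [rV hV] := rowsub_span finj uS; exists (rowsub f S); split=> // v /hV[c -> c0].
rewrite nrm_unitary // qf_coords nrmE mulr_sumr; apply: ler_sum => j _.
have [jk|kj] := leqP j k; first by rewrite ler_wpM2r ?sqmod_ge0 // eigen_antitone // jk.
rewrite c0; first by rewrite sqmod0 !mulr0.
by move=> i; apply: contraTneq kj => <- /=; rewrite -leqNgt -ltnS.
Qed.

Lemma bottom_space k : (k < n)%N -> exists V : 'M[C]_(n - k, n),
  \rank V = (n - k)%N /\ forall v : 'rV[C]_n, (v <= V)%MS -> qf M v <= eigen M k * nrm v.
Proof.
move=> kn.
have fP (i : 'I_(n - k)) : (k + i < n)%N by have := ltn_ord i; lia.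
pose f i := Ordinal (fP i).
have finj : injective f by move=> i j /(congr1 val) /= /addnI /val_inj.
have [rV hV] := rowsub_span finj uS; exists (rowsub f S); split=> // v /hV[c -> c0].
rewrite nrm_unitary // qf_coords nrmE mulr_sumr; apply: ler_sum => j _.
have [kj|jk] := leqP k j; first by rewrite ler_wpM2r ?sqmod_ge0 // eigen_antitone // kj ltn_ord.
rewrite c0; first by rewrite sqmod0 !mulr0.
by move=> i; apply: contraTneq jk => <- /=; rewrite -leqNgt leq_addr.
Qed.

(** For reasons of dimension V meets the span of the last n - k eigenvectors, where the form is at
    most [eigen M k] times the squared norm. *)
Lemma eigen_ge k m (V : 'M[C]_(m, n)) (c : R) : (k < n)%N -> (k < \rank V)%N ->
  (forall v : 'rV[C]_n, (v <= V)%MS -> c * nrm v <= qf M v) -> c <= eigen M k.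
Proof.
move=> kn kV hV; have [W [rW hW]] := bottom_space kn.
have [|v v0 /andP[vV vW]] := @meet_subspaces _ _ _ V W; first by rewrite rW; lia.
by rewrite -(ler_pM2r (nrm_gt0 v0)) (le_trans (hV v vV)) // hW.
Qed.

Lemma eigen_le k m (V : 'M[C]_(m, n)) (c : R) : (k < n)%N -> (n - k <= \rank V)%N ->
  (forall v : 'rV[C]_n, (v <= V)%MS -> qf M v <= c * nrm v) -> eigen M k <= c.
Proof.
move=> kn kV hV; have [W [rW hW]] := top_space kn.
have [|v v0 /andP[vV vW]] := @meet_subspaces _ _ _ V W; first by rewrite rW; lia.
by rewrite -(ler_pM2r (nrm_gt0 v0)) (le_trans (hW v vW)) // hV.
Qed.

End CourantFischer.

Lemma qfN n (M : 'M[C]_n) v : qf (- M) v = - qf M v.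
Proof. by rewrite /qf -scaleN1r sesqMl mulN1r cReN. Qed.

Lemma eigenN n (M : 'M[C]_n) k : M^t* = M -> (k < n)%N ->
  eigen (- M) k = - eigen M (n - k.+1).
Proof.
move=> hM kn; have hNM : (- M)^t* = - M by rewrite -scaleN1r trmxCZ rmorphN rmorph1 hM.
have [S uS SE] := hermitian_sorted_diag hM; have [S' uS' SE'] := hermitian_sorted_diag hNM.
have kn' : (n - k.+1 < n)%N by lia.
apply/le_anti/andP; split.
  have [V [rV hV]] := top_space uS SE kn'.
  apply: (eigen_le uS' SE' kn (V := V)); first by rewrite rV; lia.
  by move=> v /hV; rewrite qfN mulNr lerN2.
have [V [rV hV]] := bottom_space uS SE kn'.
apply: (eigen_ge uS' SE' kn (V := V)); first by rewrite rV; lia.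
by move=> v /hV; rewrite qfN mulNr lerN2.
Qed.

End QuadraticForms.

(** * Perturbation of a simple eigenvalue *)

(** Here l is the eigenvalue, a and beta are the sizes of the coefficients of H and H', and p and w
    are the squared norms of the components along and off the eigenvector. With the splitting weight
    8 beta B / g the cost on the second component is g w / 4, paid by the spectral gap, and that on
    the first is at most 16 B^2 beta^2 p / g, the error term. *)
Lemma perturb_arith (R : realFieldType) (a l beta delta B g p w qH Qv Qw : R) :
  0 < beta -> 0 < B -> 0 < g -> 1 / 2 <= a -> 8 * B * beta <= g ->
  `|delta| <= B -> 0 <= p -> 0 <= w -> 0 <= Qw <= 2 * B * w ->
  l * (p + w) + g * w <= qH ->
  (1 - 8 * beta * B / g) * (p * (B + delta)) + (1 - (8 * beta * B / g)^-1) * Qw <= Qv ->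
  (a * l + beta * delta - 16 * B ^+ 2 * beta ^+ 2 / g) * (p + w) <=
    a * qH + beta * (Qv - B * (p + w)).
Proof.
move=> b0 B0 g0 a2 bg; rewrite ler_norml => /andP[d1 d2] p0 w0 /andP[Q1 Q2] hH hQ.
have e0 : 0 < 8 * beta * B / g by rewrite divr_gt0 // !mulr_gt0.
have e1 : 8 * beta * B / g <= 1 by rewrite ler_pdivrMr // mul1r mulrAC.
have hw : (1 - (8 * beta * B / g)^-1) * (2 * B * w) <= (1 - (8 * beta * B / g)^-1) * Qw.
  by rewrite ler_wnM2l // subr_le0 invf_ge1.
have hp : p * (B + delta) - 8 * beta * B / g * (2 * B * p) <= (1 - 8 * beta * B / g) * (p * (B + delta)).
  have h : p * (B + delta) <= 2 * B * p by nra.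
  have := ler_wpM2l (ltW e0) h; lra.
have ha : a * (l * (p + w) + g * w) <= a * qH by rewrite ler_wpM2l //; lra.
have hgw : 1 / 2 * (g * w) <= a * (g * w) by rewrite ler_wpM2r // mulr_ge0 // ltW.
have hQv : beta * (p * (B + delta) - 8 * beta * B / g * (2 * B * p) +
   (1 - (8 * beta * B / g)^-1) * (2 * B * w)) <= beta * Qv.
  by apply: ler_wpM2l; [exact: ltW|exact: le_trans (lerD hp hw) hQ].
have E : beta * (p * (B + delta) - 8 * beta * B / g * (2 * B * p) +
   (1 - (8 * beta * B / g)^-1) * (2 * B * w)) =
   beta * p * (B + delta) - 16 * B ^+ 2 * beta ^+ 2 / g * p + 2 * (beta * B * w) - 1 / 4 * (g * w).
  by field; rewrite !gt_eqF.
have hd : beta * w * delta <= beta * w * B by rewrite ler_wpM2l // mulr_ge0 // ltW.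
have hE : 0 <= 16 * B ^+ 2 * beta ^+ 2 / g * w.
  apply: mulr_ge0 => //; apply: divr_ge0; last exact: ltW.
  by rewrite -mulrA -exprMn; apply: mulr_ge0; [rewrite ler0n | apply: sqr_ge0].
rewrite E in hQv; move: (16 * B ^+ 2 * beta ^+ 2 / g) hE hQv => K hE hQv.
have gw : 0 <= g * w by rewrite mulr_ge0 // ltW.
lra.
Qed.

Lemma norm_le_bounds (R : realDomainType) (x y : R) :
  `|x| <= y -> 0 <= y + x /\ y + x <= 2 * y.
Proof. by rewrite ler_norml => /andP[h1 h2]; split; lra. Qed.

Lemma norm_sub_le (R : realDomainType) (x y e : R) :
  y - e <= x -> - y - e <= - x -> `|x - y| <= e.
Proof. by move=> h1 h2; rewrite ler_norml; apply/andP; split; lra. Qed.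

Section Perturbation.
Variable R : realType.
Local Notation C := (R[i] : numClosedFieldType).

Lemma cReMr (a : R) (z : C) : complex.Re (a%:C%C * z) = a * complex.Re z.
Proof. by case: z => b c /=; ring. Qed.

Lemma Re_comb (a b : R) (p q s t : C) :
  complex.Re ((a%:C%C * Num.conj a%:C%C) * p + (b%:C%C * Num.conj b%:C%C) * q +
    ((a%:C%C * Num.conj b%:C%C) * s + (b%:C%C * Num.conj a%:C%C) * t)) =
  a ^+ 2 * complex.Re p + b ^+ 2 * complex.Re q +
    a * b * (complex.Re s + complex.Re t).
Proof.
case: p => p p'; case: q => q q'; case: s => s s'; case: t => t t' /=.
by rewrite /= !oppr0 !(mulr0, mul0r, subr0, addr0); ring.
Qed.

Lemma sqmodM (z w : C) : sqmod (z * w) = sqmod z * sqmod w.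
Proof. by case: z => a b; case: w => c d; rewrite /sqmod /=; ring. Qed.

Lemma qf_combine n (H H' : 'M[C]_n) (a b : R) v :
  qf (a%:C%C *: H + b%:C%C *: H') v = a * qf H v + b * qf H' v.
Proof. by rewrite /qf sesq_matD !sesqMl cReD !cReMr. Qed.

Lemma qfZ n (H : 'M[C]_n) (c : C) v : qf H (c *: v) = sqmod c * qf H v.
Proof.
rewrite /qf sesqZl sesqZr mulrA cReM /sqmod; case: c => a b /=; ring.
Qed.

(* Expand Q(r x + r^-1 y) >= 0. *)
Lemma qf_psd_split n (Q : 'M[C]_n) (r : R) (x y : 'rV[C]_n) : r != 0 ->
  (forall v, 0 <= qf Q v) ->
  (1 - r ^+ 2) * qf Q x + (1 - r ^- 2) * qf Q y <= qf Q (x + y).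
Proof.
move=> r0 Q0; have := Q0 (r%:C%C *: x + (r^-1)%:C%C *: y).
have e a b : qf Q (a%:C%C *: x + b%:C%C *: y) = a ^+ 2 * qf Q x + b ^+ 2 * qf Q y +
    a * b * (complex.Re (sesq Q x y) + complex.Re (sesq Q y x)).
  by rewrite /qf sesq_comb; apply: Re_comb.
rewrite e mulfV // mul1r exprVn.
have -> : qf Q (x + y) = qf Q x + qf Q y + (complex.Re (sesq Q x y) + complex.Re (sesq Q y x)).
  rewrite /qf sesqDl !sesqDr !cReD.
  have lem (p q s t : R) : p + s + (t + q) = p + q + (s + t) by ring.
  exact: lem.
move: (qf Q x) (qf Q y) (complex.Re _) (complex.Re _) (r ^+ 2) (r ^- 2) => p q s s' r1 r2.
by lra.
Qed.

(** In eigenvector coordinates c lives on the first k axes and e is a unit vector in the eigenspace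
    of l k. The gap is gained on c alone. *)
Lemma split_coords n (l : nat -> R) (c e : 'rV[C]_n) (s : C) k (g : R) :
  (forall j : 'I_n, (k <= j)%N -> c 0 j = 0) ->
  (forall j : 'I_n, (j < k)%N -> e 0 j = 0) ->
  (forall j : 'I_n, e 0 j = 0 \/ l j = l k) ->
  (forall j, (j < k)%N -> l k + g <= l j) -> nrm e = 1 ->
  nrm (c + s *: e) = sqmod s + nrm c /\
  l k * nrm (c + s *: e) + g * nrm c <= \sum_(j < n) l j * sqmod ((c + s *: e) 0 j).
Proof.
move=> ck e0 eP gap ne.
have entE (j : 'I_n) : (c + s *: e) 0 j = c 0 j + s * e 0 j by rewrite !mxE.
split.
  rewrite -[sqmod s]mulr1 -ne !nrmE mulr_sumr -big_split /=.
  apply: eq_bigr => j _; rewrite entE -sqmodM; have [kj|jk] := leqP k j.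
    by rewrite ck // add0r sqmod0 addr0.
  by rewrite e0 // mulr0 addr0 sqmod0 add0r.
rewrite !nrmE !mulr_sumr -big_split /=.
apply: ler_sum => j _; rewrite entE; have [kj|jk] := leqP k j.
  rewrite ck // add0r sqmod0 mulr0 addr0.
  by case: (eP j) => ->; rewrite ?mulr0 ?sqmod0 ?mulr0.
by rewrite e0 // mulr0 addr0 -mulrDl ler_wpM2r ?sqmod_ge0 // gap.
Qed.

(** The test space is spanned by z and the first k eigenvectors of H. There H exceeds [eigen H k] by
    at least g on the component off z, which pays for the cross terms of H'. *)
Lemma eigen_lower_perturb n (H H' : 'M[C]_n) (z : 'rV[C]_n) k (g B a b : R) :
  H^t* = H -> (a%:C%C *: H + b%:C%C *: H')^t* = a%:C%C *: H + b%:C%C *: H' ->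
  (k < n)%N -> 0 < g ->
  (forall j, (j < k)%N -> eigen H k + g <= eigen H j) ->
  z *m H = (eigen H k)%:C%C *: z -> nrm z = 1 ->
  0 < B -> (forall v, `|qf H' v| <= B * nrm v) ->
  1 / 2 <= a -> 8 * B * `|b| <= g ->
  a * eigen H k + b * qf H' z - 16 * B ^+ 2 * b ^+ 2 / g
    <= eigen (a%:C%C *: H + b%:C%C *: H') k.
Proof.
move=> hH hN kn g0 gap zH nz B0 hB a2 bg.
have [S uS SE] := hermitian_sorted_diag hH.
have [S' uS' SE'] := hermitian_sorted_diag hN.
pose f := widen_ord (ltnW kn); have finj : injective f by move=> i j /(congr1 val) /= /val_inj.
have [rT hT] := rowsub_span finj uS; set T := rowsub f S in rT hT.
pose e := z *m S^t*.
have zE : z = e *m S.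
  by rewrite /e -mulmxA -invmx_unitary // mulVmx ?unitarymx_unit // mulmx1.
have eE : e = z *m S^t* by [].
clearbody e.
have eP (j : 'I_n) : e 0 j = 0 \/ eigen H j = eigen H k.
  have [->|ej] := eqVneq (e 0 j) 0; [by left | right].
  have eH : e *m diag_mx (\row_j (eigen H j)%:C%C) = (eigen H k)%:C%C *: e.
    by rewrite -SE !mulmxA -zE zH -scalemxAl eE.
  have /rowP/(_ j) := eH; rewrite mul_mx_diag !mxE mulrC => /(mulIf ej).
  by move=> /(congr1 (@complex.Re R)).
have e0 (j : 'I_n) : (j < k)%N -> e 0 j = 0.
  by move=> /gap h; case: (eP j) => // E; move: h; rewrite E gerDl leNgt g0.
have split_form v : (v <= T + z)%MS -> exists c : C, exists w : 'rV[C]_n,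
    [/\ v = c *: z + w, nrm v = sqmod c + nrm w &
     eigen H k * nrm v + g * nrm w <= qf H v].
  case/sub_addsmxP => -[D1 D2] /= ->; exists (D2 0 0), (D1 *m T).
  have [c wE c0] := hT (D1 *m T) (submxMl _ _).
  have -> : D2 *m z = D2 0 0 *: z by rewrite {1}[D2]mx11_scalar mul_scalar_mx.
  set s := D2 0 0.
  have ck (j : 'I_n) : (k <= j)%N -> c 0 j = 0.
    by move=> kj; apply: c0 => i; apply: contraTneq kj => <- /=; rewrite -ltnNge.
  have vE : D1 *m T + s *: z = (c + s *: e) *m S by rewrite mulmxDl -scalemxAl -zE wE.
  have ne : nrm e = 1 by rewrite -nz zE (nrm_unitary e uS).
  have nc : nrm (D1 *m T) = nrm c by rewrite wE (nrm_unitary c uS).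
  have [nv hv] := split_coords s ck e0 eP gap ne.
  split; first by rewrite addrC.
    by rewrite vE (nrm_unitary (c + s *: e) uS) nv nc.
  by rewrite vE (nrm_unitary (c + s *: e) uS) nc (qf_coords SE).
apply: (eigen_ge uS' SE' kn (V := (T + z)%MS)).
  rewrite -[X in (X < _)%N]rT; apply: rank_adds_notin; apply/negP => zT.
  have [c zc c0] := hT z zT.
  have := nz; rewrite zc (nrm_unitary c uS) nrmE big1 => [/esym/eqP|j _].
    by rewrite oner_eq0.
  suff -> : c = e.
    have [kj|jk] := leqP k j; last by rewrite e0 // sqmod0.
    suff -> : e = c by rewrite c0 ?sqmod0 // => i; apply: contraTneq kj => <- /=; rewrite -ltnNge.
    by rewrite eE zc -mulmxA (unitarymxP uS) mulmx1.
  by rewrite eE zc -mulmxA (unitarymxP uS) mulmx1.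
move=> v /split_form [c [w [vE nv hv]]]; rewrite qf_combine.
have nw := nrm_ge0 w; have sc := sqmod_ge0 c.
(* For b = 0 the splitting parameter used below would be 0. *)
have [b0|b0] := eqVneq b 0.
  rewrite b0 !mul0r expr0n /= mulr0 mul0r subr0 !addr0 -mulrA.
  apply: ler_wpM2l; first exact: le_trans a2.
  by apply: le_trans hv; rewrite lerDl mulr_ge0 // ltW.
have nb0 : 0 < `|b| by rewrite normr_gt0.
have bE : b = `|b| * Num.sg b by rewrite mulrC -numEsg.
have b2E : b ^+ 2 = `|b| ^+ 2 by rewrite real_normK ?num_real.
pose s := Num.sg b.
(* As B bounds H', this matrix is positive semidefinite, so [qf_psd_split] controls its cross
   terms. *)
pose Q : 'M[C]_n := B%:C%C *: 1%:M + s%:C%C *: H'.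
have qQ u : qf Q u = B * nrm u + s * qf H' u by rewrite /Q qf_combine.
have hs u : `|s * qf H' u| <= B * nrm u by rewrite normrM normr_sg b0 mul1r.
have Q0 u : 0 <= qf Q u by rewrite qQ; case: (norm_le_bounds (hs u)).
have eta0 : 0 < 8 * `|b| * B / g by rewrite divr_gt0 // !mulr_gt0.
have r0 : Num.sqrt (8 * `|b| * B / g) != 0 by rewrite gt_eqF // sqrtr_gt0.
have := qf_psd_split (c *: z) w r0 Q0; rewrite -vE qfZ (qQ z) nz mulr1.
rewrite sqr_sqrtr ?(ltW eta0) // => hQ.
have dB : `|s * qf H' z| <= B by have := hs z; rewrite nz mulr1.
have Qw : 0 <= qf Q w <= 2 * B * nrm w.
  by rewrite Q0 /= qQ -mulrA; case: (norm_le_bounds (hs w)).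
rewrite nv in hv.
have := perturb_arith nb0 B0 g0 a2 bg dB sc nw Qw hv hQ.
rewrite -nv qQ -b2E [X in _ <= X -> _](_ : _ = a * qf H v + b * qf H' v); last first.
  by rewrite [B * _ + _]addrC addrK mulrA -bE.
by rewrite [in X in X -> _](_ : `|b| * (s * qf H' z) = b * qf H' z) // mulrA -bE.
Qed.

(** The upper bound is the lower bound for - H and - H', where the index k becomes n - k - 1. *)
Lemma eigen_perturb n (H H' : 'M[C]_n) (z : 'rV[C]_n) k (g B a b : R) :
  H^t* = H -> H'^t* = H' -> (k < n)%N -> 0 < g ->
  (forall j, (j < n)%N -> j != k -> g <= `|eigen H j - eigen H k|) ->
  z *m H = (eigen H k)%:C%C *: z -> nrm z = 1 ->
  0 < B -> (forall v, `|qf H' v| <= B * nrm v) ->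
  1 / 2 <= a -> 8 * B * `|b| <= g ->
  `|eigen (a%:C%C *: H + b%:C%C *: H') k - (a * eigen H k + b * qf H' z)|
     <= 16 * B ^+ 2 * b ^+ 2 / g.
Proof.
move=> hH hH' kn g0 gap zH nz B0 hB a2 bg.
have cj (t : R) : (t%:C%C)^* = t%:C%C :> C by exact: conjc_real.
have hN : (a%:C%C *: H + b%:C%C *: H')^t* = a%:C%C *: H + b%:C%C *: H'.
  by rewrite trmxCD !trmxCZ !cj hH hH'.
have low : a * eigen H k + b * qf H' z - 16 * B ^+ 2 * b ^+ 2 / g
    <= eigen (a%:C%C *: H + b%:C%C *: H') k.
  apply: eigen_lower_perturb => // j jk.
  have := gap j (ltn_trans jk kn); rewrite ltn_eqF // => /(_ isT).
  have := @eigen_antitone _ _ H j k; rewrite (ltnW jk) kn => /(_ isT) h.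
  by rewrite ger0_norm ?subr_ge0 // lerBrDl.
have hHn : (- H)^t* = - H by rewrite -scaleN1r trmxCZ rmorphN rmorph1 hH.
have kn' : (n - k.+1 < n)%N by lia.
have NE : a%:C%C *: (- H) + b%:C%C *: (- H') = - (a%:C%C *: H + b%:C%C *: H').
  by rewrite !scalerN -opprD.
have nk : (n - (n - k.+1).+1 = k)%N by lia.
have up : a * - eigen H k + b * - qf H' z - 16 * B ^+ 2 * b ^+ 2 / g
    <= - eigen (a%:C%C *: H + b%:C%C *: H') k.
  have := @eigen_lower_perturb n (- H) (- H') z (n - k.+1)%N g B a b.
  rewrite NE !(eigenN _ kn') // !nk qfN; apply => //.
  - by rewrite -[in LHS]scaleN1r trmxCZ rmorphN rmorph1 hN scaleN1r.
  - move=> j jk; rewrite eigenN //; last by lia.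
    have jn : (n - j.+1 < n)%N by lia.
    have kj : (k <= n - j.+1)%N by lia.
    have := gap _ jn; have -> : (n - j.+1 != k)%N by apply/eqP; lia.
    move=> /(_ isT); have := @eigen_antitone _ _ H k (n - j.+1)%N; rewrite kj jn => /(_ isT) h.
    rewrite ler0_norm ?subr_le0 // opprB => hg.
    by rewrite addrC lerBlDr addrC.
  - by rewrite mulmxN zH rmorphN scaleNr.
  by move=> v; rewrite qfN normrN.
by apply: norm_sub_le; [exact: low | move: up; rewrite !mulrN -opprD].
Qed.

End Perturbation.

Lemma norm_comb_bound (R : realDomainType) (c s p q a b w : R) :
  `|c| <= 1 -> `|s| <= 1 -> 0 <= w -> `|p| <= a * w -> `|q| <= b * w ->
  `|c * p + s * q| <= (a + b + 1) * w.
Proof.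
move=> c1 s1 w0 hp hq; apply: le_trans (ler_normD _ _) _; rewrite !normrM.
have h1 : `|c| * `|p| <= 1 * (a * w) by rewrite ler_pM.
have h2 : `|s| * `|q| <= 1 * (b * w) by rewrite ler_pM.
lra.
Qed.

Lemma norm_between (R : realDomainType) (x y q w : R) :
  0 <= w -> x * w <= q -> q <= y * w -> `|q| <= (`|y| + `|x|) * w.
Proof.
move=> w0 h1 h2; rewrite ler_norml mulrDl; apply/andP; split.
  have := ler_wpM2r w0 (lerNnormlW (lexx `|x|)); have : 0 <= `|y| * w by rewrite mulr_ge0.
  lra.
have := ler_wpM2r w0 (ler_norm y); have : 0 <= `|x| * w by rewrite mulr_ge0.
lra.
Qed.

(** * Hermitian parts of the rotated matrices *)

Section HermitianPart.
Variable C : numClosedFieldType.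

Lemma half_sumJ (n : nat) (X : 'M[C]_n) : (2^-1 *: (X + X^t*))^t* = 2^-1 *: (X + X^t*).
Proof.
rewrite trmxCZ trmxCD trmxCK addrC; congr (_ *: _).
by rewrite fmorphV /= conjC_nat.
Qed.

End HermitianPart.

Section Pencil.
Variable R : realType.
Local Notation C := (R[i] : numClosedFieldType).

Lemma hermitian_partJ n (X : 'M[C]_n) : (hermitian_part X)^t* = hermitian_part X.
Proof. exact: half_sumJ. Qed.

Lemma Re_half_conj (z : C) : complex.Re (2^-1 * (z + Num.conj z)) = complex.Re z.
Proof. by rewrite mulrC -[in RHS]cReJ -ReE ReC_E /= cReJ. Qed.

Lemma qf_hermitian_part n (X : 'M[C]_n) v : qf (hermitian_part X) v = qf X v.
Proof.
rewrite /qf; have -> : sesq (hermitian_part X) v v = 2^-1 * (sesq X v v + Num.conj (sesq X v v)).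
  by rewrite [LHS]sesqMl sesq_matD sesqJ.
exact: Re_half_conj.
Qed.

Lemma half_sum_lin (K : numClosedFieldType) n (a b : K) (X Y : 'M[K]_n) : a^* = a -> b^* = b ->
  2^-1 *: ((a *: X + b *: Y) + (a *: X + b *: Y)^t*) =
  a *: (2^-1 *: (X + X^t*)) + b *: (2^-1 *: (Y + Y^t*)).
Proof.
move=> ha hb; rewrite trmxCD !trmxCZ ha hb addrACA -!scalerDr.
by rewrite [LHS]scalerDr !scalerA ![2^-1 * _]mulrC.
Qed.

Definition pencil n (A : 'M[C]_n) (theta : R) : 'M[C]_n :=
  hermitian_part (cis theta *: A).

Lemma cis_add (t h : R) :
  cis (t + h) = (cos h)%:C%C * cis t + (sin h)%:C%C * cis (t + pi / 2).
Proof.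
rewrite /cis cosD sinD cosDpihalf sinDpihalf; apply/eqP; rewrite eq_complex /=.
by apply/andP; split; apply/eqP; ring.
Qed.

Lemma pencil_add n (A : 'M[C]_n) t h : pencil A (t + h) =
  (cos h)%:C%C *: pencil A t + (sin h)%:C%C *: pencil A (t + pi / 2).
Proof.
rewrite /pencil /hermitian_part cis_add scalerDl -!scalerA.
by apply: half_sum_lin; exact: conjc_real.
Qed.

Lemma qf_pencil_add n (A : 'M[C]_n) t h v : qf (pencil A (t + h)) v =
  cos h * qf (pencil A t) v + sin h * qf (pencil A (t + pi / 2)) v.
Proof. by rewrite pencil_add qf_combine. Qed.

Lemma qf_hermitian_bound n (M : 'M[C]_n) : M^t* = M ->
  exists2 B, 0 <= B & forall v, `|qf M v| <= B * nrm v.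
Proof.
case: n M => [|n] M hM.
  exists 0 => // v; rewrite mul0r [v](_ : _ = 0); last by apply/rowP; case.
  by rewrite /qf /sesq !mul0mx mxE normr0.
have [S uS SE] := hermitian_sorted_diag hM.
exists (`|eigen M 0| + `|eigen M n|); first by rewrite addr_ge0.
have [V [rV hV]] := top_space uS SE (ltnSn n).
have [W [rW hW]] := bottom_space uS SE (ltn0Sn n).
move=> v.
have vV : (v <= V)%MS by apply: submx_full; rewrite /row_full rV.
have vW : (v <= W)%MS by apply: submx_full; rewrite /row_full rW subn0.
exact: norm_between (nrm_ge0 v) (hV v vV) (hW v vW).
Qed.

(** All matrices of the pencil are combinations of two of them with coefficients cos and sin, so one
    constant serves every angle; the added 1 makes it positive. *)
Lemma pencil_bound n (A : 'M[C]_n) :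
  exists2 B, 0 < B & forall t v, `|qf (pencil A t) v| <= B * nrm v.
Proof.
have [B1 B10 h1] := qf_hermitian_bound (hermitian_partJ (cis 0 *: A)).
have [B2 B20 h2] := qf_hermitian_bound (hermitian_partJ (cis (0 + pi / 2) *: A)).
exists (B1 + B2 + 1); first by rewrite ltr_wpDl // addr_ge0.
move=> t v; rewrite -[t]add0r qf_pencil_add.
exact: norm_comb_bound (cos_max t) (sin_max t) (nrm_ge0 v) (h1 v) (h2 v).
Qed.

Lemma unit_eigenrow n (M : 'M[C]_n) k : M^t* = M -> (k < n)%N ->
  exists z : 'rV[C]_n, z *m M = (eigen M k)%:C%C *: z /\ nrm z = 1.
Proof.
move=> hM kn; have [S uS SE] := hermitian_sorted_diag hM.
pose j := Ordinal kn; exists (row j S); split.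
  have SM : S *m M = diag_mx (\row_j (eigen M j)%:C%C) *m S.
    by rewrite -SE -(invmx_unitary uS) mulmxKV ?unitarymx_unit.
  by rewrite -row_mul SM row_mul row_diag_mx -scalemxAl -rowE mxE.
rewrite /nrm /qf /sesq mulmx1.
have -> : (row j S *m (row j S)^t*) 0 0 = (S *m S^t*) j j.
  by rewrite !mxE; apply: eq_bigr => i _; rewrite !mxE.
by rewrite (unitarymxP uS) mxE eqxx.
Qed.

End Pencil.

Local Open Scope classical_set_scope.
Local Open Scope ring_scope.

(** * Derivatives from trigonometric expansions *)

Section TrigonometricExpansion.
Variable R : realType.
Implicit Types (F D : R -> R).

Lemma is_derive_trig (l d : R) : is_derive (0 : R) 1 (fun h => cos h * l + sin h * d) d.
Proof.
apply: is_derive_eq.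
by rewrite sin0 cos0 oppr0 !scaler0 !add0r [d *: _]mulr1.
Qed.

Lemma is_derive_cvg F (t d : R) :
  is_derive t 1 F d <-> (fun h : R => h^-1 * (F (h + t) - F t)) @ 0^' --> d.
Proof.
split=> [dF|cF].
  have := @ex_derive _ _ _ _ _ _ _ dF; have := @derive_val _ _ _ _ _ _ _ dF.
  rewrite /derivable /derive => <-.
  under eq_fun do rewrite [_ *: 1]mulr1.
  exact.
have cF' : h^-1 *: ((F \o shift t) (h *: (1 : R)) - F t) @[h --> 0^'] --> d.
  by under eq_fun do rewrite /= [_ *: 1]mulr1.
apply: DeriveDef; first by apply/cvg_ex; exists d.
exact/cvg_lim.
Qed.

(** The function cos h F(t) + sin h d of h has derivative d at 0, and an error of order sin^2 h does
    not change it. *)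
Lemma is_derive_trig_estimate F (t d C : R) :
  (\forall h \near (0 : R), `|F (t + h) - (cos h * F t + sin h * d)| <= C * sin h ^+ 2) ->
  is_derive t 1 F d.
Proof.
move=> est; apply/is_derive_cvg.
have /is_derive_cvg cG := is_derive_trig (F t) d.
have /is_derive_cvg cs : is_derive (0 : R) 1 (@sin R) 1 by have := is_derive_sin (0 : R); rewrite cos0.
pose q h : R := `|C| * (sin h * (h^-1 * (sin (h + 0) - sin 0))).
have cq : q @ 0^' --> 0.
  suff : q @ 0^' --> `|C| * (0 * 1) by rewrite mul0r mulr0.
  apply: cvgM; first exact: cvg_cst.
  apply: cvgM => //; have : sin x @[x --> (0 : R)] --> sin (0 : R) := @continuous_sin R 0.
  rewrite sin0 => c0.
  exact: cvg_within_filter.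
have -> : (fun h => h^-1 * (F (h + t) - F t)) =
  (fun h => h^-1 * ((cos (h + 0) * F t + sin (h + 0) * d) - (cos 0 * F t + sin 0 * d))) \+
  (fun h => h^-1 * (F (t + h) - (cos h * F t + sin h * d))).
  apply/funext => h /=; rewrite cos0 sin0 addr0 mul0r mul1r addr0 -mulrDr [t + h]addrC.
  by congr (_ * _); ring.
suff h0 : h^-1 * (F (t + h) - (cos h * F t + sin h * d)) @[h --> 0^'] --> (0 : R).
  by have := cvgD cG h0; rewrite addr0; apply.
apply/norm_cvg0P; apply: (@squeeze_cvgr _ _ _ _ (fun=> 0) (fun h => `|q h|)).
- near=> h; rewrite normr_ge0 /= normrM.
  have est' : `|F (t + h) - (cos h * F t + sin h * d)| <= C * sin h ^+ 2.
    by near: h; exact: nbhs_dnbhs.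
  have -> : q h = h^-1 * (`|C| * sin h ^+ 2) by rewrite /q sin0 addr0 subr0; ring.
  have nn : 0 <= `|C| * sin h ^+ 2 by apply: mulr_ge0 => //; exact: sqr_ge0.
  rewrite [leRHS]normrM (ger0_norm nn); apply: ler_wpM2l => //.
  by apply: le_trans est' _; apply: ler_wpM2r; [exact: sqr_ge0 | exact: ler_norm].
- exact: (cvg_cst (0 : R)).
- by have := cvg_norm cq; rewrite normr0; apply.
Unshelve. all: by end_near. Qed.

Lemma one_sub_cos_le (h : R) : 0 <= cos h -> 1 - cos h <= sin h ^+ 2.
Proof. move=> c0; rewrite sin2cos2; have := cos_le1 h; nra. Qed.

Lemma sin_neq0_near0 : \forall h \near (0 : R), h != 0 -> sin h != 0.
Proof.
near=> h; move=> h0.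
have h1 : `|h| < 1 by near: h; apply: (@cvgr0_norm_lt _ R).
have pos (x : R) : 0 < x -> x < 1 -> 0 < sin x.
  by move=> x0 x1; apply: sin2_gt0; rewrite x0; lra.
have [h2|h2|h2] := ltgtP h 0; last by move: h0; rewrite h2 eqxx.
  have := pos (- h); rewrite sinN oppr_gt0 oppr_gt0 => /(_ h2) s0.
  by rewrite lt_eqF // s0 // (le_lt_trans _ h1) // -normrN ler_norm.
by rewrite gt_eqF // pos // (le_lt_trans _ h1) // ler_norm.
Unshelve. all: by end_near. Qed.

Lemma cos_near0_ge : \forall h \near (0 : R), 1 / 2 <= cos h.
Proof.
have c : cos x @[x --> (0 : R)] --> cos (0 : R) := @continuous_cos R 0.
rewrite cos0 in c; near=> h; apply: ltW.
by near: h; apply: (cvgr_gt _ c); lra.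
Unshelve. all: by end_near. Qed.

Lemma sin_cvg0 : sin x @[x --> (0 : R)] --> (0 : R).
Proof.
by have : sin x @[x --> (0 : R)] --> sin (0 : R) := @continuous_sin R 0; rewrite sin0.
Qed.

(** Adding the two expansions gives s (D0 - D1) = (1 - c) (F0 + F1) up to errors of order s^2. Since
    1 - c is of that order too, division by s gives the bound. *)
Lemma trig_coefficient_gap (F0 F1 D0 D1 c s C : R) : 0 <= C -> s != 0 ->
  0 <= c -> c <= 1 -> `|s| <= 1 -> 1 - c <= s ^+ 2 ->
  `|F1 - (c * F0 + s * D0)| <= C * s ^+ 2 ->
  `|F0 - (c * F1 - s * D1)| <= C * s ^+ 2 ->
  `|D0 - D1| <= (3 * C + 2 * `|F0| + `|D0|) * `|s|.
Proof.
move=> C0 s0 c0 c1 s1 cs f1 f2.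
have ns0 : 0 < `|s| by rewrite normr_gt0.
have s21 : s ^+ 2 <= 1 by rewrite -[s ^+ 2]real_normK ?num_real // exprn_ile1.
have F1le : `|F1| <= C + `|F0| + `|D0|.
  rewrite -[leRHS]addrA -[X in `|X| <= _](subrK (c * F0 + s * D0) F1).
  apply: le_trans (ler_normD _ _) _; apply: lerD.
    by apply: le_trans f1 _; rewrite -[leRHS]mulr1 ler_wpM2l.
  apply: le_trans (ler_normD _ _) _; rewrite !normrM (ger0_norm c0).
  by apply: lerD; rewrite -[leRHS]mul1r ler_wpM2r.
rewrite -(ler_pM2r ns0) -normrM -mulrA -expr2 real_normK ?num_real //.
have -> : (D0 - D1) * s = - ((F0 - (c * F1 - s * D1)) + (F1 - (c * F0 + s * D0)) - (1 - c) * (F0 + F1)) by ring.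
rewrite normrN; apply: le_trans (ler_normB _ _) _.
have h1 := ler_normD (F0 - (c * F1 - s * D1)) (F1 - (c * F0 + s * D0)).
have h2 : `|(1 - c) * (F0 + F1)| <= s ^+ 2 * (`|F0| + (C + `|F0| + `|D0|)).
  rewrite normrM (ger0_norm (_ : 0 <= 1 - c)) ?subr_ge0 //.
  apply: ler_pM => //; rewrite ?subr_ge0 //.
  by apply: le_trans (ler_normD _ _) _; rewrite lerD2l.
move: h1 h2 f1 f2; lra.
Qed.

(* The two expansions, at t and at t + h, together bound D (t + h) - D t. *)
Lemma continuous_trig_coefficient F D (t C : R) : 0 <= C ->
  (\forall h \near (0 : R), `|F (t + h) - (cos h * F t + sin h * D t)| <= C * sin h ^+ 2) ->
  (\forall h \near (0 : R),
     `|F t - (cos h * F (t + h) - sin h * D (t + h))| <= C * sin h ^+ 2) ->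
  D x @[x --> t] --> D t.
Proof.
move=> C0 e1 e2.
suff h0 : D (t + h) @[h --> (0 : R)] --> D t.
  have := cvg_comp_shift t 0 D; rewrite add0r => <-.
  by rewrite /comp /=; under eq_fun do rewrite addrC.
apply/cvgrPdist_le => /= eps eps0.
pose K := 3 * C + 2 * `|F t| + `|D t|.
have K0 : 0 <= K by rewrite !addr_ge0 // ?mulr_ge0.
near=> h.
have [->|h0] := eqVneq h 0; first by rewrite addr0 subrr normr0 ltW.
have s0 : sin h != 0.
  by move: h0; near: h; exact: sin_neq0_near0.
have c2 : 1 / 2 <= cos h by near: h; exact: cos_near0_ge.
have f1 : `|F (t + h) - (cos h * F t + sin h * D t)| <= C * sin h ^+ 2 by near: h.
have f2 : `|F t - (cos h * F (t + h) - sin h * D (t + h))| <= C * sin h ^+ 2 by near: h.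
have sK : K * `|sin h| <= eps.
  have h1 : `|sin h| <= eps / (K + 1).
    by near: h; apply: (@cvgr0_norm_le _ _ _ _ _ _ sin_cvg0); rewrite divr_gt0 // ltr_wpDl.
  apply: (@le_trans _ _ ((K + 1) * `|sin h|)); first by rewrite ler_wpM2r // lerDl.
  by rewrite mulrC -ler_pdivlMr // ltr_wpDl.
have c0 : 0 <= cos h by apply: le_trans c2; rewrite divr_ge0.
apply: le_trans sK; exact: trig_coefficient_gap C0 s0 c0 (cos_le1 h) (sin_max h)
  (one_sub_cos_le c0) f1 f2.
Unshelve. all: by end_near. Qed.
End TrigonometricExpansion.

Lemma finite_positive_bound (R : realType) (P : pred nat) (f : nat -> R) n :
  (forall j, (j < n)%N -> P j -> 0 < f j) ->
  exists2 g, 0 < g & forall j, (j < n)%N -> P j -> g <= f j.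
Proof.
elim: n => [|n IH] h; first by exists 1.
have [j jn Pj|g g0 gP] := IH; first by apply: h => //; apply: ltnW.
have [Pn|Pn] := boolP (P n); last first.
  exists g => // j; rewrite ltnS leq_eqVlt => /orP[/eqP ->|]; last exact: gP.
  by rewrite (negbTE Pn).
exists (Num.min g (f n)); first by rewrite lt_min g0 h.
move=> j; rewrite ltnS leq_eqVlt => /orP[/eqP -> _|jn Pj]; first by rewrite ge_min lexx orbT.
by rewrite ge_min gP.
Qed.

Lemma one_sided_combine (R : realDomainType) (c s p q a w B : R) :
  0 <= w -> a * w <= p -> `|p| <= B * w -> `|q| <= B * w ->
  (a - B * (`|c - 1| + `|s|)) * w <= c * p + s * q.
Proof.
move=> w0 ha hp hq.
have h1 : - (`|c - 1| * (B * w)) <= (c - 1) * p.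
  by apply: lerNnormlW; rewrite normrM ler_wpM2l.
have h2 : - (`|s| * (B * w)) <= s * q.
  by apply: lerNnormlW; rewrite normrM ler_wpM2l.
have -> : c * p + s * q = p + (c - 1) * p + s * q by ring.
have -> : (a - B * (`|c - 1| + `|s|)) * w =
  a * w - `|c - 1| * (B * w) - `|s| * (B * w) by ring.
by rewrite !lerD.
Qed.

Lemma gap_transfer (R : realDomainType) (g x y x' y' : R) :
  4 * g <= `|x - y| -> `|x' - x| <= g -> `|y' - y| <= g -> g <= `|x' - y'|.
Proof.
move=> h hx hy.
have : `|x - y| <= `|x - x'| + `|x' - y'| + `|y' - y|.
  have -> : x - y = (x - x') + (x' - y') + (y' - y) by ring.
  by apply: le_trans (ler_normD _ _) _; rewrite lerD2r ler_normD.
have := normr_ge0 (x' - x); rewrite [`|x - x'|]distrC; lra.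
Qed.

(** * Differentiability of the eigenvalues of a generic matrix *)

Section EigenvalueCurves.
Variables (R : realType) (n : nat).
Local Notation C := (R[i] : numClosedFieldType).
Variable A : 'M[C]_n.
Let lam (j : nat) (t : R) := eigen (pencil A t) j.

Lemma pencilJ t : (pencil A t)^t* = pencil A t.
Proof. exact: hermitian_partJ. Qed.

Lemma eigen_pencil_lower B j t h : (forall t v, `|qf (pencil A t) v| <= B * nrm v) ->
  (j < n)%N -> lam j t - B * (`|cos h - 1| + `|sin h|) <= lam j (t + h).
Proof.
move=> hB jn; have [S uS SE] := hermitian_sorted_diag (pencilJ t).
have [S' uS' SE'] := hermitian_sorted_diag (pencilJ (t + h)).
have [V [rV hV]] := top_space uS SE jn.
apply: (eigen_ge uS' SE' jn (V := V)); first by rewrite rV.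
move=> v vV; rewrite qf_pencil_add.
exact: one_sided_combine (nrm_ge0 v) (hV v vV) (hB t v) (hB (t + pi / 2) v).
Qed.

(** Exchanging t and t + h makes the one-sided bound two-sided, with one constant for all indices
    and angles. *)
Lemma eigen_pencil_dist : exists2 B, 0 < B & forall j t h, (j < n)%N ->
  `|lam j (t + h) - lam j t| <= B * (`|cos h - 1| + `|sin h|).
Proof.
have [B B0 hB] := pencil_bound A; exists B => // j t h jn.
have h1 := eigen_pencil_lower t h hB jn.
have h2 := eigen_pencil_lower (t + h) (- h) hB jn.
rewrite cosN sinN normrN addrK in h2.
move: (lam j t) (lam j (t + h)) (B * _) h1 h2 => x y e h1 h2.
by rewrite ler_norml; apply/andP; split; lra.
Qed.

Lemma cos_sub1_sin_cvg0 : `|cos h - 1| + `|sin h| @[h --> (0 : R)] --> (0 : R).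
Proof.
have c : cos x @[x --> (0 : R)] --> cos (0 : R) := @continuous_cos R 0.
rewrite cos0 in c.
suff : `|cos h - 1| + `|sin h| @[h --> (0 : R)] --> `|(1 : R) - 1| + `|(0 : R)|.
  by rewrite subrr normr0 addr0.
apply: cvgD; apply: cvg_norm; last exact: sin_cvg0.
by apply: cvgB => //; exact: cvg_cst.
Qed.

Lemma eigen_pencil_near t e : 0 < e -> \forall h \near (0 : R),
  forall j, (j < n)%N -> `|lam j (t + h) - lam j t| <= e.
Proof.
move=> e0; have [B B0 hB] := eigen_pencil_dist.
near=> h; move=> j jn.
apply: le_trans (hB j t h jn) _; rewrite mulrC -ler_pdivlMr //.
rewrite -[leLHS]ger0_norm ?addr_ge0 //.
by near: h; apply: (@cvgr0_norm_le _ _ _ _ _ _ cos_sub1_sin_cvg0); rewrite divr_gt0.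
Unshelve. all: by end_near. Qed.

Hypothesis gen : generic A.
Variable k : nat.
Hypothesis kn : (k < n)%N.

(** Genericity gives a positive gap at t, and nearby each eigenvalue moves by at most a quarter of
    it. The expansion at t + h needs such a gap independent of h. *)
Lemma gap_near t : exists2 g, 0 < g &
  \forall h \near (0 : R), forall j, (j < n)%N -> j != k ->
    g <= `|lam j (t + h) - lam k (t + h)|.
Proof.
have [|g g0 gP] := @finite_positive_bound R (fun j => j != k) (fun j => `|lam j t - lam k t|) n.
  move=> j jn jk; rewrite normr_gt0 subr_eq0; apply/eqP.
  have := gen; rewrite /generic => /(_ t j.+1 k.+1); rewrite /= jn kn.
  by apply=> // -[/eqP]; rewrite (negbTE jk).
exists (g / 4); first by rewrite divr_gt0.
have g40 : 0 < g / 4 by apply: divr_gt0.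
have := @eigen_pencil_near t _ g40.
apply: filterS => h hh j jn jk.
apply: gap_transfer (hh j jn) (hh k kn).
by rewrite mulrC divfK ?gP // pnatr_eq0.
Qed.

Definition unit_eigen t (z : 'rV[C]_n) :=
  z *m pencil A t = (lam k t)%:C%C *: z /\ nrm z = 1.

(** The first part expands L(t + h) at t, the second expands L(t) at t + h by the angle - h. The
    uniform gap gives both the same constant. *)
Lemma pencil_estimate t : exists2 K, 0 <= K &
  \forall h \near (0 : R),
    (forall z, unit_eigen t z ->
      `|lam k (t + h) - (cos h * lam k t + sin h * qf (pencil A (t + pi / 2)) z)|
        <= K * sin h ^+ 2) /\
    (forall z, unit_eigen (t + h) z ->
      `|lam k t - (cos h * lam k (t + h) - sin h * qf (pencil A (t + h + pi / 2)) z)|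
        <= K * sin h ^+ 2).
Proof.
have [g g0 gP] := gap_near t; have [B B0 hB] := pencil_bound A.
exists (16 * B ^+ 2 / g).
  by apply: divr_ge0; [apply: mulr_ge0; [rewrite ler0n | exact: sqr_ge0] | exact: ltW].
have gB : 0 < g / (8 * B) by apply: divr_gt0 => //; apply: mulr_gt0.
near=> h.
have c2 : 1 / 2 <= cos h by near: h; exact: cos_near0_ge.
have sg : 8 * B * `|sin h| <= g.
  rewrite mulrC -ler_pdivlMr ?mulr_gt0 //.
  by near: h; have /cvgr0Pnorm_le h1 := @sin_cvg0 R; exact: h1.
have gap0 j : (j < n)%N -> j != k -> g <= `|lam j t - lam k t|.
  move=> jn jk; have := nbhs_singleton gP; rewrite addr0; exact.
have gaph j : (j < n)%N -> j != k -> g <= `|lam j (t + h) - lam k (t + h)|.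
  by move=> jn jk; move: j jn jk; near: h.
have comm : 16 * B ^+ 2 / g * sin h ^+ 2 = 16 * B ^+ 2 * sin h ^+ 2 / g by rewrite mulrAC.
split=> z [zH nz]; rewrite comm.
  rewrite /lam pencil_add.
  exact: (eigen_perturb (pencilJ t) (pencilJ _) kn g0 gap0 zH nz B0 (hB _) c2 sg).
have sgN : 8 * B * `|- sin h| <= g by rewrite normrN.
have -> : lam k t = eigen ((cos h)%:C%C *: pencil A (t + h) + (- sin h)%:C%C *: pencil A (t + h + pi / 2)) k.
  by rewrite -sinN -(cosN h) -pencil_add addrK.
rewrite -mulNr -[sin h ^+ 2]sqrrN.
exact: (eigen_perturb (pencilJ (t + h)) (pencilJ _) kn g0 gaph zH nz B0 (hB _) c2 sgN).
Unshelve. all: by end_near. Qed.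

Lemma hellmann_feynman t z : unit_eigen t z ->
  is_derive t 1 (lam k) (qf (pencil A (t + pi / 2)) z).
Proof.
move=> uz; have [K K0 hK] := pencil_estimate t.
apply: (@is_derive_trig_estimate _ _ _ _ K).
by apply: filterS hK => h [h1 _]; apply: h1.
Qed.

(** The eigenvectors z s are chosen arbitrarily; the expansions from both ends already force the
    values of the form to converge. *)
Lemma hellmann_feynman_continuous (z : R -> 'rV[C]_n) t : (forall s, unit_eigen s (z s)) ->
  qf (pencil A (s + pi / 2)) (z s) @[s --> t] --> qf (pencil A (t + pi / 2)) (z t).
Proof.
move=> uz; have [K K0 hK] := pencil_estimate t.
apply: (@continuous_trig_coefficient _ (lam k) (fun s => qf (pencil A (s + pi / 2)) (z s)) t K) => //.
  by apply: filterS hK => h [h1 _]; apply: h1.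
by apply: filterS hK => h [_ h2]; apply: h2.
Qed.

End EigenvalueCurves.

(** * The rank-k numerical range *)

Section Compressions.
Variable C : numClosedFieldType.

(** Gram-Schmidt turns k independent vectors of the isotropic space into orthonormal rows U, for
    which U A U^* is the scalar mu; then P is U^* U. *)
Lemma isotropic_projection n k (A : 'M[C]_n) (mu : C) : isotropic k (A - mu%:M) ->
  exists P : 'M[C]_n, [/\ P *m P = P, P^t* = P, \rank P = k & P *m A *m P = mu *: P].
Proof.
move=> [V [rV iV]].
pose W : 'M[C]_(k, n) := pid_mx k *m row_base V.
have fW : row_free W.
  by rewrite /row_free /W mxrankMfree ?row_base_free // rank_pid_mx.
have kn : (k <= n)%N by rewrite (leq_trans rV) // rank_leq_col.
pose U := schmidt W.
have /unitarymxP UU : U \is unitarymx by apply: schmidt_unitarymx.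
have UV : (U <= V)%MS.
  by rewrite /U (eqmx_schmidt_free fW) (submx_trans (submxMl _ _)) // eq_row_base.
have UA : U *m A *m U^t* = mu%:M.
  have := isotropic_sub iV UV; rewrite mulmxBr mulmxBl => /eqP; rewrite subr_eq0 => /eqP ->.
  by rewrite mul_mx_scalar -scalemxAl UU scalemx1.
exists (U^t* *m U); split.
- by rewrite mulmxA -[X in X *m _]mulmxA UU mulmx1.
- by rewrite trmxC_mul trmxCK.
- apply/eqP; rewrite eqn_leq; apply/andP; split.
    by apply: leq_trans (mxrankM_maxr _ _) _; apply: rank_leq_row.
  have rU : \rank U = k by apply: mxrank_unitary; apply: schmidt_unitarymx.
  have := mxrankM_maxr U (U^t* *m U); rewrite mulmxA UU mul1mx rU; exact.
have -> : U^t* *m U *m A *m (U^t* *m U) = U^t* *m (U *m A *m U^t*) *m U by rewrite !mulmxA.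
by rewrite UA mul_mx_scalar -scalemxAl.
Qed.

Lemma projection_sesq n (A P : 'M[C]_n) (mu : C) (v : 'rV[C]_n) :
  P *m P = P -> P^t* = P -> P *m A *m P = mu *: P -> (v <= P)%MS ->
  sesq A v v = mu * sesq 1%:M v v.
Proof.
move=> PP Pt PAP /submxP[w ->].
rewrite !sesq_mul Pt PAP sesqMl mulmx1 PP //.
Qed.

Lemma sesq_column n (A : 'M[C]_n) (z : 'cV[C]_n) :
  sesq A (z^t*) (z^t*) = \sum_i (A *m z) i 0 * (z i 0)^*.
Proof.
rewrite /sesq trmxCK -mulmxA mxE; apply: eq_bigr => i _.
by rewrite mulrC; congr (_ * _); rewrite !mxE.
Qed.

Lemma eigen_column_row n (M : 'M[C]_n) (a : C) (z : 'cV[C]_n) : M^t* = M -> a^* = a ->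
  M *m z = a *: z -> z^t* *m M = a *: z^t*.
Proof. by move=> hM ha h; rewrite -{1}hM -trmxC_mul h trmxCZ ha. Qed.

Lemma sesq1_real n (v : 'rV[C]_n) : (sesq 1%:M v v)^* = sesq 1%:M v v.
Proof. by rewrite sesqJ trmx1 map_mx1. Qed.

Lemma sesq_shift n (A : 'M[C]_n) (mu : C) (v : 'rV[C]_n) :
  sesq (A - mu%:M) v v = sesq A v v - mu * sesq 1%:M v v.
Proof. by rewrite -(scalemx1 _ mu) -scaleNr sesq_matD sesqMl mulNr. Qed.

End Compressions.

Section RankRange.
Variable R : realType.
Local Notation C := (R[i] : numClosedFieldType).

Lemma sesq1E n (v : 'rV[C]_n) : sesq 1%:M v v = (nrm v)%:C%C.
Proof.
have := sesq1_real v; rewrite /nrm /qf.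
by case: (sesq 1%:M v v) => a b [] h; congr Complex; lra.
Qed.

Lemma polar (u : R[i]) : u != 0 ->
  exists r t : R, [/\ 0 < r, 0 <= t < 2 * pi & u = r%:C%C * cis t].
Proof.
case: u => a b u0; pose r := Num.sqrt (a ^+ 2 + b ^+ 2).
have s0 : 0 < a ^+ 2 + b ^+ 2.
  rewrite lt_neqAle addr_ge0 ?sqr_ge0 // andbT eq_sym paddr_eq0 ?sqr_ge0 // !sqrf_eq0.
  by move: u0; rewrite eq_complex.
have r0 : 0 < r by rewrite sqrtr_gt0.
have rr : r ^+ 2 = a ^+ 2 + b ^+ 2 by rewrite sqr_sqrtr // ltW.
have ar : -1 <= a / r <= 1.
  rewrite -ler_norml normrM normfV (gtr0_norm r0) ler_pdivrMr // mul1r.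
  by rewrite -(@ler_pXn2r _ 2) ?nnegrE ?(ltW r0) // real_normK ?num_real // rr lerDl sqr_ge0.
have ca : cos (acos (a / r)) = a / r by apply: acosK; rewrite in_itv.
have sa : sin (acos (a / r)) = `|b| / r.
  rewrite sin_acos // (_ : 1 - _ = (b / r) ^+ 2); last first.
    by rewrite !expr_div_n rr; field; rewrite gt_eqF.
  by rewrite sqrtr_sqr normrM normfV (gtr0_norm r0).
have ra (x : R) : r * (x / r) = x by rewrite mulrC divfK // gt_eqF.
have [b0|b0] := leP 0 b.
  exists r, (acos (a / r)); split=> //.
    by rewrite acos_ge0 //= (le_lt_trans (acos_lepi ar)) // ltr_pMl ?pi_gt0 // ltr1n.
  apply/eqP; rewrite eq_complex /= ca sa (ger0_norm b0) !mul0r subr0 addr0.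
  by rewrite !ra !eqxx.
exists r, (2 * pi - acos (a / r)); split=> //.
  rewrite subr_ge0 (le_trans (acos_lepi ar)) ?ler_peMl ?pi_ge0 ?ler1n //= ltrBlDr ltrDl.
  (* Since b is nonzero, a / r is not 1, so the arc cosine is positive and the angle stays below 2
     pi. *)
  apply: acos_gt0; case/andP: ar => -> /=; move=> h; rewrite lt_neqAle h andbT.
  apply/eqP => ar1; have : b ^+ 2 = 0.
    have : a = r by rewrite -[LHS](divfK (lt0r_neq0 r0)) ar1 mul1r.
    by move=> ar'; move: rr; rewrite -ar'; lra.
  by move/eqP; rewrite sqrf_eq0 lt_eqF.
have pi2E : 2 * pi - acos (a / r) = - acos (a / r) + pi *+ 2 by rewrite mulr2n; ring.
apply/eqP; rewrite eq_complex /=.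
have -> : cos (2 * pi - acos (a / r)) = a / r.
  by rewrite pi2E cosD2pi cosN ca.
have -> : sin (2 * pi - acos (a / r)) = b / r.
  by rewrite pi2E sinD2pi sinN sa (ltr0_norm b0) mulNr opprK.
by rewrite !mul0r subr0 addr0 !ra !eqxx.
Qed.

Lemma Re_affine (r x : R) (w s mu : C) : complex.Re (r%:C%C * w * (s - mu * x%:C%C)) =
  r * (complex.Re (w * s) - complex.Re (w * mu) * x).
Proof.
by case: w => w w'; case: s => s s'; case: mu => m m' /=; ring.
Qed.

(** On the range of P the form of A is mu times the squared norm, and min-max gives one inclusion.
    Conversely, for u of argument t the inequality at t makes u times the form of A - mu have
    nonnegative real part on the span of the first k eigenvectors of L(t); no direction u has to be
    excluded. *)
Lemma rank_numerical_rangeE n (A : 'M[C]_n) k : (0 < k <= n)%N ->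
  rank_numerical_range k A = \bigcap_(theta in [set theta : R | 0 <= theta < 2 * pi])
    half_plane (lambda A k) theta.
Proof.
case: k => // k /= kn; apply/seteqP; split=> mu.
  move=> [P [[PP Pt] rP PAP]] t _; rewrite /half_plane /=.
  have [S uS SE] := hermitian_sorted_diag (pencilJ A t).
  apply: (eigen_ge uS SE kn (V := P)); first by rewrite rP.
  move=> v vP; rewrite qf_hermitian_part /qf sesqMl (projection_sesq PP Pt PAP vP) sesq1E.
  by rewrite mulrA [X in _ <= complex.Re X]mulrC cReMr mulrC.
move=> hmu; have : isotropic k.+1 (A - mu%:M).
  apply: isotropic_of_halfplane; exists [::] => // u u0 _.
  have [r [t [r0 t2 uE]]] := polar u0.
  have [S uS SE] := hermitian_sorted_diag (pencilJ A t).
  have [V [rV hV]] := top_space uS SE kn.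
  exists <<V>>%MS; rewrite genmxE rV; split=> // v; rewrite genmxE => /hV hv.
  have sE : sesq (A - mu%:M) v v = sesq A v v - mu * (nrm v)%:C%C.
    by rewrite -sesq1E; apply: sesq_shift.
  rewrite Re_ge0E sE uE Re_affine; apply: mulr_ge0; first exact: ltW.
  rewrite subr_ge0; have h1 : complex.Re (cis t * mu) <= lambda A k.+1 t by apply: hmu.
  apply: le_trans (ler_wpM2r (nrm_ge0 v) h1) _; apply: le_trans hv _.
  by rewrite qf_hermitian_part /qf sesqMl.
case/isotropic_projection => P [PP Pt rP PAP].
by exists P.
Qed.

End RankRange.

(** * Envelopes *)

Section Topology.
Variable R : realType.
Local Notation C := (R[i] : numClosedFieldType).

Lemma Re_cis_mul (t : R) (mu : R[i]) :
  complex.Re (cis t * mu) = cos t * complex.Re mu - sin t * complex.Im mu.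
Proof. by case: mu. Qed.

Lemma Re_cis_dist (t : R) (mu nu : R[i]) (e : R) : `|mu - nu| < e%:C%C ->
  `|complex.Re (cis t * mu) - complex.Re (cis t * nu)| < e.
Proof.
case: mu => a b; case: nu => c d; rewrite normc_def ltcR /= => h.
apply: le_lt_trans h.
rewrite -sqrtr_sqr ler_sqrt ?addr_ge0 ?sqr_ge0 //.
have := sqr_ge0 (sin t * (a - c) + cos t * (b - d)).
have -> : cos t * a - sin t * b - (cos t * c - sin t * d) = cos t * (a - c) - sin t * (b - d) by ring.
have := cos2Dsin2 t; move: (cos t) (sin t) (a - c) (b - d) => x y p q xy h.
have -> : p ^+ 2 + q ^+ 2 = (x * p - y * q) ^+ 2 + (y * p + x * q) ^+ 2.
  by rewrite -[LHS]mul1r -xy; ring.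
by rewrite lerDl.
Qed.

Lemma near_Re_cis (t : R) (mu : R[i]) (e : R) : 0 < e ->
  \forall nu \near (mu : R[i]^o), `|complex.Re (cis t * mu) - complex.Re (cis t * nu)| < e.
Proof.
move=> e0; apply/nbhs_ballP; exists e%:C%C; first by rewrite /= ltcR.
move=> nu; rewrite -ball_normE /=; exact: Re_cis_dist.
Qed.

Lemma boundary_half_plane (h : R -> R) (t : R) :
  boundary (half_plane h t) = line h t.
Proof.
apply/seteqP; split=> mu; rewrite /boundary /line /half_plane /=.
  move=> [cl int]; apply/le_anti/andP; split.
    rewrite leNgt; apply/negP => lt; have e0 : 0 < complex.Re (cis t * mu) - h t by rewrite subr_gt0.
    have [nu [/= nu1 nu2]] := cl _ (near_Re_cis t mu e0).
    by move: nu2; rewrite ltr_norml => /andP[_]; lra.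
  rewrite leNgt; apply/negP => lt; apply: int.
  have e0 : 0 < h t - complex.Re (cis t * mu) by rewrite subr_gt0.
  apply: filterS (near_Re_cis t mu e0) => nu; rewrite /= ltr_norml => /andP[]; lra.
move=> muE; split; first by apply: subset_closure => /=; rewrite muE.
move=> /nbhs_ballP[[e e'] /= e0 sub].
have [e0' ee] : 0 < e /\ e' = 0.
  by move: e0; rewrite ltcE /= => /andP[/eqP -> ->].
(* The point moved by e / 2 along the outward normal, the conjugate of cis t, stays in the ball but
   leaves the half-plane. *)
have := sub (mu + (e / 2)%:C%C * Num.conj (cis t)); rewrite -ball_normE /=.
have -> : mu - (mu + (e / 2)%:C%C * Num.conj (cis t)) = - ((e / 2)%:C%C * Num.conj (cis t)).
  by rewrite opprD addrA subrr add0r.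
rewrite normrN normc_def ltcE /= ee eqxx /=.
have e20 : 0 < e / 2 by rewrite divr_gt0.
have -> : Num.sqrt ((e / 2 * cos t - 0 * - sin t) ^+ 2 + (e / 2 * - sin t + 0 * cos t) ^+ 2) = e / 2.
  rewrite (_ : _ + _ = (e / 2) ^+ 2 * (cos t ^+ 2 + sin t ^+ 2)); last by ring.
  by rewrite cos2Dsin2 mulr1 sqrtr_sqr gtr0_norm.
have -> : e / 2 < e by rewrite ltr_pdivrMr // ltr_pMr // ltr1n.
move=> /(_ isT); rewrite mulrDr cReD muE.
have -> : complex.Re (cis t * ((e / 2)%:C%C * Num.conj (cis t))) = e / 2 * (cos t ^+ 2 + sin t ^+ 2).
  by rewrite /=; ring.
by rewrite cos2Dsin2 mulr1 gerDl leNgt e20.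
Qed.

Lemma is_derive_Re_cis (t : R) (mu : R[i]) :
  is_derive t 1 (fun s : R => complex.Re (cis s * mu)) (complex.Re (cis (t + pi / 2) * mu)).
Proof.
have -> : (fun s : R => complex.Re (cis s * mu)) =
  (fun s => cos s * complex.Re mu - sin s * complex.Im mu).
  by apply/funext => s; apply: Re_cis_mul.
apply: is_derive_eq.
rewrite Re_cis_mul cosDpihalf sinDpihalf !scaler0 !add0r.
rewrite /GRing.scale /=; ring.
Qed.

(** Up to sign, the two real parts are the coordinates of a point in the frame turned by t. *)
Lemma Re_cis_quarter_eq (t : R) (mu nu : R[i]) :
  complex.Re (cis t * mu) = complex.Re (cis t * nu) ->
  complex.Re (cis (t + pi / 2) * mu) = complex.Re (cis (t + pi / 2) * nu) -> mu = nu.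
Proof.
rewrite !Re_cis_mul cosDpihalf sinDpihalf; case: mu => a b; case: nu => c d /=.
have := cos2Dsin2 t; move: (cos t) (sin t) => x y xy h1 h2.
have e1 (p q : R) : p = x * (x * p - y * q) - y * (- y * p - x * q).
  by rewrite -[LHS]mul1r -xy; ring.
have e2 (p q : R) : q = - y * (x * p - y * q) - x * (- y * p - x * q).
  by rewrite -[LHS]mul1r -xy; ring.
have -> : a = c by rewrite (e1 a b) h1 h2 -e1.
by have -> : b = d by rewrite (e2 a b) h1 h2 -e2.
Qed.

Lemma is_derive_unique (f : R -> R) (t d d' : R) :
  is_derive t 1 f d -> is_derive t 1 f d' -> d = d'.
Proof. by move=> h h'; rewrite -(@derive_val _ _ _ _ _ _ _ h) (@derive_val _ _ _ _ _ _ _ h'). Qed.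

(** The equation of the line fixes one coordinate in the turned frame, and the differentiated
    equation fixes the other. *)
Lemma tangency_pointP (h : R -> R) (t d : R) (g : R[i]) :
  is_derive t 1 h d -> complex.Re (cis t * g) = h t ->
  complex.Re (cis (t + pi / 2) * g) = d ->
  forall mu, tangency_point h t mu <-> mu = g.
Proof.
move=> hd gh gd mu; split.
  move=> [ml [d' [md' hd']]]; apply: (@Re_cis_quarter_eq t).
    by rewrite gh -ml.
  rewrite gd (is_derive_unique hd hd').
  exact: is_derive_unique (is_derive_Re_cis t mu) md'.
move=> ->; split=> //; exists d; split=> //.
by rewrite -gd; apply: is_derive_Re_cis.
Qed.

Lemma is_derive_sign_shift (f f' : R -> R) (s T t d : R) :
  (forall x, f' (x + T) = s * f x) -> is_derive t 1 f d -> is_derive (t + T) 1 f' (s * d).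
Proof.
move=> ff' /is_derive_cvg df; apply/is_derive_cvg.
have -> : (fun h : R => h^-1 * (f' (h + (t + T)) - f' (t + T))) =
  (fun h => s * (h^-1 * (f (h + t) - f t))).
  by apply/funext => h; rewrite addrA !ff' -mulrBr mulrCA.
by apply: cvgM => //; exact: cvg_cst.
Qed.

(** Serves half turns, with s = -1 and T = pi or - pi, and the full turn, with s = 1 and T = 2
    pi. *)
Lemma tangency_point_shift (h h' : R -> R) (s T t : R) (mu : R[i]) :
  (forall x, h' (x + T) = s * h x) ->
  (forall x, cos (x + T) = s * cos x) -> (forall x, sin (x + T) = s * sin x) ->
  tangency_point h t mu -> tangency_point h' (t + T) mu.
Proof.
move=> hh hc hs; have cE x : complex.Re (cis (x + T) * mu) = s * complex.Re (cis x * mu).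
  by rewrite !Re_cis_mul hc hs; ring.
move=> [ml [d [md hd]]]; split; first by rewrite /line /= cE hh ml.
exists (s * d); split; last exact: is_derive_sign_shift hd.
by apply: is_derive_sign_shift md.
Qed.

Lemma cvg_complex (f : R -> R[i]) (t : R) :
  complex.Re (f s) @[s --> t] --> complex.Re (f t) ->
  complex.Im (f s) @[s --> t] --> complex.Im (f t) ->
  (f : R -> R[i]^o) s @[s --> t] --> (f t : R[i]^o).
Proof.
move=> /cvgrPdist_lt hr /cvgrPdist_lt hi; apply/cvgrPdist_lt => -[e e'] /=.
(* In the order on complex numbers a positive radius is real. *)
rewrite ltcE /= => /andP[/eqP -> e0].
have e20 : 0 < e / 2 by rewrite divr_gt0.
near=> s.
have h1 : `|complex.Re (f t) - complex.Re (f s)| < e / 2 by near: s; apply: hr.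
have h2 : `|complex.Im (f t) - complex.Im (f s)| < e / 2 by near: s; apply: hi.
move: h1 h2; case: (f t) => a b; case: (f s) => c d /= h1 h2.
rewrite normc_def ltcR /=.
apply: (@le_lt_trans _ _ (`|a - c| + `|b - d|)); last by move: h1 h2; lra.
rewrite -(real_normK (num_real (a - c))) -(real_normK (num_real (b - d))).
move: (normr_ge0 (a - c)) (normr_ge0 (b - d)); move: `|a - c| `|b - d| => p q p0 q0.
rewrite -[leRHS]ger0_norm ?addr_ge0 // -sqrtr_sqr ler_sqrt ?sqr_ge0 // sqrrD.
by have := mulr_ge0 p0 q0; lra.
Unshelve. all: by end_near. Qed.

End Topology.

Lemma sesq_eigen (K : numClosedFieldType) n (M : 'M[K]_n) (a : K) (w : 'rV[K]_n) :
  w *m M = a *: w -> sesq M w w = a * sesq 1%:M w w.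
Proof. by move=> h; rewrite /sesq h mulmx1 -scalemxAl mxE. Qed.

(** * Points of tangency as values of the form at eigenvectors *)

Section Curves.
Variables (R : realType) (n : nat).
Local Notation C := (R[i] : numClosedFieldType).
Variable A : 'M[C]_n.

Lemma unit_eigenvector_row k t (z : 'cV[C]_n) :
  unit_eigenvector (hermitian_part (cis t *: A)) (lambda A k.+1 t) z ->
  unit_eigen A k t (z^t*).
Proof.
move=> [Mz zz]; split.
  by apply: eigen_column_row Mz; [exact: hermitian_partJ | exact: conjc_real].
by rewrite /nrm /qf sesq_column mul1mx [X in complex.Re X]zz.
Qed.

Lemma gamma_paramE (z : R -> 'cV[C]_n) t :
  gamma_param A z t = sesq A ((z t)^t*) ((z t)^t*).
Proof. by rewrite sesq_column. Qed.

Lemma qf_pencil t w : qf (pencil A t) w = complex.Re (cis t * sesq A w w).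
Proof. by rewrite qf_hermitian_part /qf sesqMl. Qed.

Lemma unit_eigen_qf k t w : unit_eigen A k t w ->
  complex.Re (cis t * sesq A w w) = lambda A k.+1 t.
Proof.
move=> [wM nw]; rewrite -qf_pencil /qf (sesq_eigen wM) sesq1E nw.
by rewrite mulr1.
Qed.

Hypothesis gen : generic A.
Variable k : nat.
Hypothesis kn : (k < n)%N.

Lemma tangency_eigen t w : unit_eigen A k t w ->
  forall mu, tangency_point (lambda A k.+1) t mu <-> mu = sesq A w w.
Proof.
move=> uw; apply: tangency_pointP (hellmann_feynman gen kn uw) (unit_eigen_qf uw) _.
by rewrite qf_pencil.
Qed.

(** Rotating back by t expresses both coordinates through the eigenvalue and its derivative, which
    are continuous for any choice of w. *)
Lemma unit_eigen_continuous (w : R -> 'rV[C]_n) : (forall t, unit_eigen A k t (w t)) ->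
  continuous ((fun t => sesq A (w t) (w t)) : R -> R[i]^o).
Proof.
move=> uw t; pose D s := qf (pencil A (s + pi / 2)) (w s).
have cD : D s @[s --> t] --> D t by exact: (hellmann_feynman_continuous gen kn uw).
have cL : lambda A k.+1 s @[s --> t] --> lambda A k.+1 t.
  have dL := @ex_derive _ _ _ _ _ _ _ (hellmann_feynman gen kn (uw t)).
  by apply/differentiable_continuous/derivable1_diffP.
have cc : cos s @[s --> t] --> cos t := @continuous_cos R t.
have cs : sin s @[s --> t] --> sin t := @continuous_sin R t.
have GE s : complex.Re (sesq A (w s) (w s)) = cos s * lambda A k.+1 s - sin s * D s /\
    complex.Im (sesq A (w s) (w s)) = - (sin s * lambda A k.+1 s) - cos s * D s.
  rewrite -(unit_eigen_qf (uw s)) /D qf_pencil !Re_cis_mul cosDpihalf sinDpihalf.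
  move: (complex.Re _) (complex.Im _) => p q; have := cos2Dsin2 s.
  move: (cos s) (sin s) => x y xy.
  by split; rewrite -[LHS]mul1r -xy; ring.
apply: cvg_complex.
  rewrite (GE t).1; under eq_fun do rewrite (GE _).1.
  by apply: cvgB; apply: cvgM.
rewrite (GE t).2; under eq_fun do rewrite (GE _).2.
by apply: cvgB; [apply: cvgN|]; apply: cvgM.
Qed.

End Curves.

(** * Symmetry under half a turn *)

Section Symmetry.
Variables (R : realType) (n : nat).
Local Notation C := (R[i] : numClosedFieldType).
Variable A : 'M[C]_n.

(** The shift negates L(t), which reverses the order of its eigenvalues. Describing T by its effect
    on cos and sin covers both pi and - pi. *)
Lemma lambda_opp T k t : (forall x : R, cos (x + T) = - 1 * cos x) ->
  (forall x : R, sin (x + T) = - 1 * sin x) ->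
  (0 < k <= n)%N -> lambda A (n.+1 - k) (t + T) = - 1 * lambda A k t.
Proof.
move=> hc hs /andP[k0 kn].
have pE : pencil A (t + T) = - pencil A t.
  have := pencil_add A t pi; rewrite cospi sinpi => e.
  have cE : cis (t + T) = cis (t + pi).
    by rewrite /cis hc hs cosDpi sinDpi !mulN1r.
  rewrite [LHS]/pencil cE -/(pencil A (t + pi)) e.
  by rewrite rmorph0 scale0r addr0 rmorphN1 scaleN1r.
rewrite -[LHS]/(eigen (pencil A (t + T)) _) pE eigenN; first last.
- by rewrite /=; lia.
- exact: hermitian_partJ.
rewrite mulN1r; congr (- eigen _ _); lia.
Qed.

Lemma envelope_opp k : (0 < k <= n)%N ->
  envelope (lambda A k) `<=` envelope (lambda A (n.+1 - k)).
Proof.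
move=> kn mu [t /andP[t0 t2] tp].
have hc (x : R) : cos (x + pi) = - 1 * cos x by rewrite cosDpi mulN1r.
have hs (x : R) : sin (x + pi) = - 1 * sin x by rewrite sinDpi mulN1r.
have hc' (x : R) : cos (x + - pi) = - 1 * cos x.
  by rewrite -[in RHS](subrK pi x) cosDpi mulN1r opprK.
have hs' (x : R) : sin (x + - pi) = - 1 * sin x.
  by rewrite -[in RHS](subrK pi x) sinDpi mulN1r opprK.
(* The half turn is made in the direction that keeps the angle in the allowed range. *)
have [tpi|tpi] := ltP t pi.
  exists (t + pi); first by have := pi_gt0 R; lra.
  by apply: (tangency_point_shift _ hc hs tp) => x; apply: lambda_opp.
exists (t + - pi); first by have := pi_gt0 R; lra.
by apply: (tangency_point_shift _ hc' hs' tp) => x; apply: lambda_opp.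
Qed.

Lemma tangency_period k t mu :
  tangency_point (lambda A k) t mu -> tangency_point (lambda A k) (t + 2 * pi) mu.
Proof.
have e : 2 * pi = pi *+ 2 :> R by rewrite mulr_natl.
have hc (x : R) : cos (x + 2 * pi) = 1 * cos x by rewrite e cosD2pi mul1r.
have hs (x : R) : sin (x + 2 * pi) = 1 * sin x by rewrite e sinD2pi mul1r.
apply: (tangency_point_shift _ hc hs) => x.
by rewrite /lambda /cis hc hs !mul1r.
Qed.

End Symmetry.

(** * The Kippenhahn curve and the rank-k ranges of a generic matrix *)

Unset Implicit Arguments.

Theorem theorem3 (R : realType) (n : nat) (A : 'M[R[i]]_n)
    (z : nat -> R -> 'cV[R[i]]_n)
    (hA : generic A)
    (hz : forall (k : nat) (theta : R), (1 <= k <= uphalf n)%N ->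
       0 <= theta <= 2 * pi ->
       unit_eigenvector (hermitian_part (cis theta *: A))
                        (lambda A k theta) (z k theta)) :
  kippenhahn_curve A
    = \bigcup_(k in [set k : nat | (1 <= k <= uphalf n)%N]) gamma A (z k)
  /\
  forall k : nat, (1 <= k <= uphalf n)%N ->
    [/\ closed_curve (gamma_param A (z k)),
        rank_numerical_range k A
          = \bigcap_(theta in [set theta : R | 0 <= theta < 2 * pi])
              half_plane (lambda A k) theta,
        forall theta : R, 0 <= theta < 2 * pi ->
          boundary (half_plane (lambda A k) theta) = line (lambda A k) theta,
        gamma A (z k) = envelope (lambda A k)
      & forall (theta : R), 0 <= theta <= 2 * pi -> forall mu : R[i],
          tangency_point (lambda A k) theta mu
          <-> mu = gamma_param A (z k) theta].
Proof.
have pi2 : 0 < 2 * pi :> R by apply: mulr_gt0 => //; apply: pi_gt0.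
have le_n k : (1 <= k <= uphalf n)%N -> (0 < k <= n)%N.
  by move=> /andP[-> h]; rewrite (leq_trans h) // leq_uphalf_double -addnn leq_addr.
have uz k t : (1 <= k <= uphalf n)%N -> 0 <= t <= 2 * pi ->
    unit_eigen A k.-1 t ((z k t)^t*).
  by move=> hk ht; have := hz k t hk ht; case: k hk => // k hk; apply: unit_eigenvector_row.
have tang k t : (1 <= k <= uphalf n)%N -> 0 <= t <= 2 * pi -> forall mu : R[i],
    tangency_point (lambda A k) t mu <-> mu = gamma_param A (z k) t.
  move=> hk ht mu; rewrite gamma_paramE; have := uz k t hk ht; have := le_n k hk.
  by case: k hk => // k hk kn uw; apply: tangency_eigen.
have h0 : 0 <= (0 : R) <= 2 * pi by rewrite lexx ltW.
have h2pi : 0 <= (2 * pi : R) <= 2 * pi by rewrite lexx ltW.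
(* The eigenvectors at 0 and 2 pi may differ, but both values are the unique point of tangency on
   the same line. *)
have per k : (1 <= k <= uphalf n)%N -> gamma_param A (z k) 0 = gamma_param A (z k) (2 * pi).
  move=> hk; apply/(tang k _ hk h2pi); rewrite -[2 * pi]add0r.
  by apply: tangency_period; apply/(tang k _ hk h0).
have gE k : (1 <= k <= uphalf n)%N -> gamma A (z k) = envelope (lambda A k).
  move=> hk; apply/seteqP; split=> mu.
    (* The angle 2 pi belongs to the range for [gamma] but not for [envelope], and is replaced by
       0. *)
    move=> [t /andP[t0]]; rewrite le_eqVlt => /orP[/eqP -> ->|t2 ->].
      by exists 0; [rewrite lexx | apply/(tang k _ hk h0); rewrite per].
    exists t; first by rewrite t0.
    by apply/(tang k _ hk) => //; rewrite t0 ltW.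
  move=> [t /andP[t0 t2]] /(tang k t hk) h; exists t; first by rewrite t0 ltW.
  by apply: h; rewrite t0 ltW.
split.
  apply/seteqP; split=> mu [k /= hk].
    move=> mk; have [ku|uk] := leqP k (uphalf n).
      by exists k; [rewrite /= ku andbT; case/andP: hk | rewrite gE //; case/andP: hk => ->].
    (* An index beyond [uphalf n] is reflected to n + 1 - k, whose envelope contains the given
       one. *)
    have hk' : (1 <= n.+1 - k <= uphalf n)%N.
      by move: hk uk; rewrite uphalf_half; have := odd_double_half n; case: (odd n) => /=; lia.
    by exists (n.+1 - k)%N => //; rewrite gE //; apply: envelope_opp.
  by move=> mk; exists k; [exact: le_n | rewrite -gE].
move=> k hk; split.
- split; last exact: per.
  have kn : (k.-1 < n)%N by have := le_n k hk; case: (k).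
  (* As [z] is prescribed on [0, 2 pi] only, continuity is shown for eigenvectors [w] chosen at all
     angles. On the interval both curves give the point of tangency, so they agree. *)
  have /choice[w uw] : forall t, exists w, unit_eigen A k.-1 t w.
    by move=> t; apply: unit_eigenrow (pencilJ A t) kn.
  have cw := unit_eigen_continuous hA kn uw.
  apply: (@subspace_eq_continuous _ _ _ (fun t => sesq A (w t) (w t) : R[i]^o)).
    move=> t; rewrite inE /= in_itv /= => ht.
    rewrite -[RHS]/(gamma_param A (z k) t) gamma_paramE; apply/(tangency_eigen hA kn (uz k t hk ht)).
    exact/(tangency_eigen hA kn (uw t)).
  exact: continuous_subspaceT.
- exact: rank_numerical_rangeE (le_n k hk).
- by move=> t _; apply: boundary_half_plane.
- exact: gE.
by move=> t ht; apply: tang.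
Qed.
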